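(* Let $A\subset\mathbb{R}^d$ be closed and let $B\subseteq\mathbb{R}^d$ be a Borel set such that $V_{A,B}(r)$ is finite for some and hence all $r>0$. Then, for each $r>0$, the one-sided derivatives $(V_{A,B})'_-(r)$ and $(V_{A,B})'_+(r)$ and the relative Minkowski content $\mathcal{M}^{d-1}(\partial(A_r),\pi_A^{-1}(B))$ exist, and $$\mathcal{M}^{d-1}(\partial(A_r),\pi_A^{-1}(B))=\frac12\left((V_{A,B})'_-(r)+(V_{A,B})'_+(r)\right).$$
   Context: $\lambda_d$ is Lebesgue measure on $\mathbb{R}^d$, $d(x,A)$ is Euclidean distance, and $A_r:=\{z\in\mathbb{R}^d: d(z,A)<r\}$ is the open $r$-parallel set of $A$, with boundary $\partial(A_r)$. $\mathrm{Unp}(A)$ is the set of points of $\mathbb{R}^d$ having a unique nearest point in $\overline{A}$, $\pi_A:\mathrm{Unp}(A)\to\overline A$ maps a point to its nearest point, and $\pi_A^{-1}(B)=\{x\in\mathrm{Unp}(A):\pi_A(x)\in B\}$. The local parallel volume is $V_{A,B}(r):=\lambda_d(A_r\cap\pi_A^{-1}(B))$, $r>0$; it is either infinite for all $r>0$ or finite for all $r>0$. For $C,\Omega\subset\mathbb{R}^d$ and $s\ge 0$ the $s$-dimensional Minkowski content of $C$ relative to $\Omega$ is $\mathcal{M}^s(C,\Omega):=\lim_{t\searrow0}\frac{\lambda_d(C_t\cap\Omega)}{\kappa_{d-s}t^{d-s}}$ whenever the limit exists, where $\kappa_t:=\pi^{t/2}/\Gamma(1+t/2)$ (so $\kappa_1=2$).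 $f'_-$ and $f'_+$ denote left and right derivatives. *)

(* Defs.v *)
From HB Require Import structures.
From mathcomp Require Import all_boot all_order all_algebra.
From mathcomp Require Import all_classical all_reals all_analysis.

Set Implicit Arguments.
Unset Strict Implicit.
Unset Printing Implicit Defensive.

Import Order.TTheory GRing.Theory Num.Theory.
Import numFieldTopology.Exports numFieldNormedType.Exports.

Local Open Scope classical_set_scope.
Local Open Scope ring_scope.

Section euclidean_space.
Context {R : realType} {d : nat}.
Implicit Types (x z a b : 'rV[R]_d) (A B C X Omega : set 'rV[R]_d).

(* The norm `|x| of the library on 'rV[R]_d is the sup norm; it induces the
   same topology, but distances below are Euclidean. *)
Definition enorm x : R := Num.sqrt (\sum_i x ord0 i ^+ 2).

(* The distance to the empty set is +oo. *)
Definition dist_set z A : \bar R :=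
  ereal_inf [set (enorm (z - a))%:E | a in A].

Definition parallel_set A (r : R) : set 'rV[R]_d :=
  [set z | (dist_set z A < r%:E)%E].

Definition boundary X : set 'rV[R]_d := closure X `\` X°.

Definition nearest A x : set 'rV[R]_d :=
  [set a | closure A a /\
           forall b, closure A b -> enorm (x - a) <= enorm (x - b)].

Definition Unp A : set 'rV[R]_d := [set x | exists! a, nearest A x a].

(* Only meaningful on Unp A. *)
Definition metric_proj A x : 'rV[R]_d := get (nearest A x).

Definition metric_proj_preimage A B : set 'rV[R]_d :=
  Unp A `&` metric_proj A @^-1` B.

Definition borel B : Prop := <<s @open 'rV[R]_d >> B.

Definition box a b : set 'rV[R]_d :=
  [set x | forall i, a ord0 i < x ord0 i <= b ord0 i].

Definition box_volume a b : R :=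
  \prod_i Num.max 0 (b ord0 i - a ord0 i).

(* d-dimensional Lebesgue measure, as the infimum of the total volumes of
   countable covers by half-open boxes.  As for the library's one-dimensional
   lebesgue_measure, the function is defined on all sets (Lebesgue outer
   measure) and is a measure on the Caratheodory-measurable ones, which
   include the Borel sets.  The local parallel sets are Borel, since Unp A is
   Borel and metric_proj A is continuous on it. *)
Definition lebesgue_rV X : \bar R :=
  ereal_inf [set (\sum_(0 <= k <oo) (box_volume (Q k).1 (Q k).2)%:E)%E |
    Q in [set Q : nat -> 'rV[R]_d * 'rV[R]_d |
            X `<=` \bigcup_k box (Q k).1 (Q k).2]].

Definition local_parallel_volume A B (r : R) : \bar R :=
  lebesgue_rV (parallel_set A r `&` metric_proj_preimage A B).

Definition Gamma (s : R) : R :=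
  (\int[lebesgue_measure]_(u in `]0%R, +oo[) (u `^ (s - 1) * expR (- u)))%R.

Definition kappa (t : R) : R := pi `^ (t / 2) / Gamma (1 + t / 2).

Definition has_minkowski_content (s : R) C Omega (M : \bar R) : Prop :=
  (lebesgue_rV (parallel_set C t `&` Omega)
     * ((kappa (d%:R - s) * t `^ (d%:R - s))^-1)%:E)%E @[t --> 0^'+] --> M.

End euclidean_space.

Section one_sided_derivatives.
Context {R : realType}.

(* For functions with values in \bar R; a finite limit D%:E of the difference
   quotients forces the function to be finite at r and near r on that side. *)
Definition has_left_derivative (V : R -> \bar R) (r D : R) : Prop :=
  ((V (r + h)%R - V r) * (h^-1)%:E)%E @[h --> 0^'-] --> D%:E.

Definition has_right_derivative (V : R -> \bar R) (r D : R) : Prop :=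
  ((V (r + h)%R - V r) * (h^-1)%:E)%E @[h --> 0^'+] --> D%:E.

End one_sided_derivatives.

(* Main.v *)
Require Import Defs.
From HB Require Import structures.
From mathcomp Require Import all_boot all_order all_algebra.
From mathcomp Require Import all_classical all_reals all_analysis.
From mathcomp Require Import ring lra.
Import Order.TTheory GRing.Theory Num.Theory.
Import numFieldTopology.Exports numFieldNormedType.Exports.

(** Write d_A for the distance to A, Y for the set of points having a unique
    foot (nearest point) in A and whose foot lies in B, and v r for the volume
    of the part of Y where d_A < r.

    Push every point z of Y towards its foot until its distance to A is divided
    by k >= 1.  The foot does not change, so the result is still in Y, and the
    inverse of this map is k-Lipschitz ([shrink_expands]).  A k-Lipschitz map
    enlarges volumes at most by the factor k ^ d ([lebesgue_lipschitz_image]),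
    hence v (k b) - v (k a) <= k ^ d (v b - v a) ([local_volume_kneser]).
    Comparing shells in geometric progression turns this inequality into
    concavity of v as a function of r ^ d ([kneser_concave]), and a concave
    function has one-sided derivatives.

    The collar of width t of the boundary of A_r lies where
    r - t <= d_A < r + t, so the part of it in Y has volume at most
    v (r + t) - v (r - t).  Conversely, a point of Y with r <= d_A < r + t is in
    the collar, since the segment to its foot crosses the boundary
    ([collar_outer]).  A point z of Y with r - t < d_A z < r may be far from the
    boundary, because the ray from its foot through z can stop being minimizing
    before the level r.  But the points whose ray does reach a level s < r
    contain all the copies, pushed towards A, of the shell s <= d_A < r; summing
    the Lipschitz bound over a geometric progression of such copies shows that
    they fill the inner collar up to the volume predicted by the left derivative
    ([extendable_volume_ge]).  As s increases to r these sets decrease, and by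
    compactness their intersection is in the collar ([bigcap_extendable_sub]).
    So the collar has volume t (v'_-(r) + v'_+(r)) + o(t), and it only remains to
    divide by kappa_1 t = 2 t, which rests on Gamma (3/2) = sqrt pi / 2.

    The set Y is cut along open sets only, and these split the outer measure of
    every set additively ([open_caratheodory]). *)

Set Implicit Arguments.
Unset Strict Implicit.
Unset Printing Implicit Defensive.

Local Open Scope classical_set_scope.
Local Open Scope ring_scope.

(** * Lebesgue outer measure of R^d and Caratheodory sets *)

Section lebesgue_outer_measure.
Context {R : realType} {n : nat}.
Notation T := 'rV[R]_n.+1.
Notation lambda := (@lebesgue_rV R n.+1).
Implicit Types (a b x : T) (X Y : set T).

Lemma box_volume_ge0 a b : 0 <= box_volume a b.
Proof. by apply: prodr_ge0 => i _; rewrite le_max lexx. Qed.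

Let total_volume_ge0 (Q : nat -> T * T) (N : nat) :
  (0 <= \sum_(N <= k <oo) (box_volume (Q k).1 (Q k).2)%:E)%E.
Proof. by apply: nneseries_ge0 => k _ _; rewrite lee_fin box_volume_ge0. Qed.

Lemma lebesgue_rV_ge0 X : (0 <= lambda X)%E.
Proof. by apply: le_ereal_inf_tmp => _ [Q _ <-]; exact: total_volume_ge0. Qed.

Lemma le_lebesgue_rV : {homo lambda : X Y / X `<=` Y >-> (X <= Y)%E}.
Proof.
move=> X Y XY; apply: ereal_inf_le_tmp => _ [Q YQ <-]; exists Q => //.
exact: subset_trans YQ.
Qed.

Lemma lebesgue_rV_box a b : (lambda (box a b) <= (box_volume a b)%:E)%E.
Proof.
pose Q k : T * T := if k is 0%N then (a, b) else (0, 0).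
apply: ereal_inf_lbound; exists Q => [x abx|]; first by exists 0%N.
rewrite nneseries_recl // => [|k _]; last by rewrite lee_fin box_volume_ge0.
rewrite [X in (_ + X)%E](_ : _ = 0%E) ?adde0 //.
rewrite eseries_cond eseries0 // => -[|k] // _ _ /=; congr EFin.
by rewrite /box_volume big_ord_recl subrr maxxx mul0r.
Qed.

Lemma lebesgue_rV0 : lambda set0 = 0%E.
Proof.
apply/eqP; rewrite eq_le lebesgue_rV_ge0 andbT.
apply: (le_trans (le_lebesgue_rV (@sub0set _ (box 0 0)))).
apply: (le_trans (lebesgue_rV_box 0 0)).
by rewrite lee_fin /box_volume big_ord_recl subrr maxxx mul0r.
Qed.

(** Choose for the k-th set a cover that is optimal up to e / 2 ^ k.+1, and
    reindex the union of these covers by a bijection of nat with nat * nat. *)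
Lemma lebesgue_rV_sigma_subadditive : sigma_subadditive lambda.
Proof.
move=> A; have [[i ioo]|] := pselect (exists i, lambda (A i) = +oo%E).
  rewrite (eseries_pinfty _ _ ioo) ?leey// => k _.
  by rewrite -ltNye (lt_le_trans _ (lebesgue_rV_ge0 _)).
rewrite -forallNE => Aoo; apply/lee_addgt0Pr => e e0.
apply: (le_trans _ (epsilon_trick _ _ (ltW e0))); last first.
  by move=> k; exact: lebesgue_rV_ge0.
pose vol (q : T * T) := (box_volume q.1 q.2)%:E.
have vol_ge0 q : (0 <= vol q)%E by rewrite lee_fin box_volume_ge0.
pose P k (Q : nat -> T * T) := A k `<=` \bigcup_j box (Q j).1 (Q j).2 /\
  (\sum_(0 <= j <oo) vol (Q j) <= lambda (A k) + (e / (2 ^ k.+1)%:R)%:E)%E.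
have [G PG] : {G : nat -> nat -> T * T & forall k, P k (G k)}.
  apply: (@choice _ _ P) => k.
  have fA : lambda (A k) \is a fin_num.
    by rewrite ge0_fin_numE ?lebesgue_rV_ge0// ltey; apply/eqP/Aoo.
  have ek : (0 < e / (2 ^ k.+1)%:R)%R by rewrite divr_gt0 ?ltr0n ?expn_gt0.
  have [_ [Q AQ <-] Qlt] := lb_ereal_inf_adherent ek fA.
  by exists Q; split => //; exact: ltW.
have /card_esym/ppcard_eqP[f] := card_nat2.
apply: (@le_trans _ _ (\sum_(0 <= j <oo) vol (G (f j).1 (f j).2))%E).
  apply: ereal_inf_lbound; exists (fun j => G (f j).1 (f j).2) => // x [k _ Akx].
  have [j _ Gx] := (PG k).1 x Akx.
  by exists (f^-1%FUN (k, j)) => //=; rewrite invK ?inE.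
rewrite nneseries_esumT// -(@reindex_esum _ _ _ [set: nat] [set: nat * nat] f
  (fun p => vol (G p.1 p.2))); last exact: bij.
rewrite (_ : [set: nat * nat] = [set: nat] `*`` (fun=> [set: nat])); last first.
  by apply/seteqP; split=> // p _; split.
rewrite -(@esum_esum R nat nat setT (fun=> setT) (fun k j => vol (G k j)))//.
rewrite -nneseries_esumT => [|k]; last exact: esum_ge0.
apply: lee_nneseries => [k _ _|k _]; first exact: esum_ge0.
by rewrite -nneseries_esumT//; exact: (PG k).2.
Qed.

HB.instance Definition _ := isOuterMeasure.Build R T lambda lebesgue_rV0
  lebesgue_rV_ge0 le_lebesgue_rV lebesgue_rV_sigma_subadditive.

(** An outer measure is compared with Lebesgue measure by testing it on boxes;
    both the behaviour of volumes under affine maps and the Lipschitz bound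
    below are obtained in this way. *)
Lemma le_mul_lebesgue_rV (m : {outer_measure set T -> \bar R}) (c : R) X :
  0 < c -> (forall a b, (m (box a b) <= (c * box_volume a b)%:E)%E) ->
  (m X <= c%:E * lambda X)%E.
Proof.
move=> c0 mc; rewrite -lee_pdivrMl//; apply: le_ereal_inf_tmp => _ [Q XQ <-].
rewrite lee_pdivrMl//; apply: (le_trans (le_outer_measure m _ _ XQ)).
apply: (le_trans (outer_measure_sigma_subadditive m _)).
rewrite -nneseriesZl => [|k _]; last by rewrite lee_fin box_volume_ge0.
apply: lee_nneseries => [k _ _|k _]; first exact: outer_measure_ge0.
by rewrite -EFinM; exact: mc.
Qed.


Definition set_coord (x : T) (i : 'I_n.+1) (c : R) : T :=
  \row_j if j == i then c else x ord0 j.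

Lemma box_volume_split a b (i : 'I_n.+1) (c : R) :
  box_volume a (set_coord b i (Num.min (b ord0 i) c)) +
  box_volume (set_coord a i (Num.max (a ord0 i) c)) b = box_volume a b.
Proof.
rewrite /box_volume !(bigD1 i (P := xpredT)) //= !mxE eqxx.
rewrite (eq_bigr (fun j => Num.max 0 (b ord0 j - a ord0 j))); last first.
  by move=> j /negbTE ji; rewrite mxE ji.
rewrite [X in _ + _ * X](eq_bigr (fun j => Num.max 0 (b ord0 j - a ord0 j))).
  rewrite -mulrDl; congr (_ * _).
  by have [|] := leP (b ord0 i) c; have [|] := leP (a ord0 i) c => h1 h2;
    rewrite /Num.max; do ![case: ifPn]; lra.
by move=> j /negbTE ji; rewrite mxE ji.
Qed.

Lemma box_halfspace a b (i : 'I_n.+1) (c : R) :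
  box a b `&` [set x : T | x ord0 i <= c] `<=`
  box a (set_coord b i (Num.min (b ord0 i) c)).
Proof.
move=> x [abx /= xc] j; have /andP[aj bj] := abx j; rewrite aj !mxE /=.
by case: eqP => // ij; rewrite le_min -ij bj /= ij.
Qed.

Lemma box_halfspaceC a b (i : 'I_n.+1) (c : R) :
  box a b `&` ~` [set x : T | x ord0 i <= c] `<=`
  box (set_coord a i (Num.max (a ord0 i) c)) b.
Proof.
move=> x [abx /= /negP]; rewrite -ltNge => xc j.
have /andP[aj bj] := abx j; rewrite bj !mxE andbT.
by case: eqP => // ij; rewrite gt_max -ij aj /= ij.
Qed.

(** A coordinate hyperplane cuts each box of a cover into two boxes whose
    volumes add up to that of the box. *)
Lemma halfspace_caratheodory (i : 'I_n.+1) (c : R) :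
  lambda.-caratheodory [set x : T | x ord0 i <= c].
Proof.
apply: le_caratheodory_measurable => X; apply: le_ereal_inf_tmp => _ [Q XQ <-].
pose Q1 k := ((Q k).1, set_coord (Q k).2 i (Num.min ((Q k).2 ord0 i) c)).
pose Q2 k := (set_coord (Q k).1 i (Num.max ((Q k).1 ord0 i) c), (Q k).2).
apply: (@le_trans _ _ (\sum_(0 <= k <oo) (box_volume (Q1 k).1 (Q1 k).2)%:E
    + \sum_(0 <= k <oo) (box_volume (Q2 k).1 (Q2 k).2)%:E)%E).
  apply: leeD; apply: ereal_inf_lbound.
  - exists Q1 => // x [/XQ[k _ Qx] xc]; exists k => //.
    exact: (@box_halfspace (Q k).1 (Q k).2 i c).
  - exists Q2 => // x [/XQ[k _ Qx] xc]; exists k => //.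
    exact: (@box_halfspaceC (Q k).1 (Q k).2 i c).
rewrite -nneseriesD; last 2 first.
- by move=> k _ _; rewrite lee_fin box_volume_ge0.
- by move=> k _ _; rewrite lee_fin box_volume_ge0.
apply: lee_nneseries => [k _ _|k _]; first by rewrite -EFinD lee_fin addr_ge0 ?box_volume_ge0.
by rewrite -EFinD lee_fin box_volume_split.
Qed.

Lemma box_caratheodory a b : lambda.-caratheodory (box a b).
Proof.
have -> : box a b = \big[setI/setT]_(i < n.+1)
    ([set x : T | x ord0 i <= b ord0 i] `\` [set x : T | x ord0 i <= a ord0 i]).
  apply/seteqP; split=> [x abx|x].
    elim/big_ind : _ => // i _ /=; have /andP[ai bi] := abx i.
    by split => //; apply/negP; rewrite -ltNge.
  move=> Ix i; have : ([set x : T | x ord0 i <= b ord0 i] `\`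
      [set x : T | x ord0 i <= a ord0 i]) x.
    by move: Ix; rewrite (bigD1 i) //= => -[].
  by move=> [/= -> /negP]; rewrite -ltNge => ->.
elim/big_ind : _ => [|X Y|i _].
- by rewrite -setC0; exact/caratheodory_measurable_setC/caratheodory_measurable_set0.
- exact: caratheodory_measurable_setI.
- by apply: caratheodory_measurable_setD; exact: halfspace_caratheodory.
Qed.

(** An open set is the union of the grid boxes that it contains, over all grids
    of mesh 1 / N.+1: there are countably many of them. *)
Lemma open_caratheodory (U : set T) : open U -> lambda.-caratheodory U.
Proof.
move=> oU; pose I := (nat * {ffun 'I_n.+1 -> int})%type.
pose B (p : I) : set T := box (\row_i ((p.2 i - 1)%:~R / p.1.+1%:R))
                         (\row_i ((p.2 i)%:~R / p.1.+1%:R)).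
pose F k : set T := if unpickle k is Some p then
   if `[< B p `<=` U >] then B p else set0 else set0.
have -> : U = \bigcup_k F k.
  apply/seteqP; split=> [x Ux|x [k _]]; last first.
    by rewrite /F; case: (unpickle k) => // p; case: ifPn => // /asboolP; apply.
  have /nbhs_ballP[e /= e0 xeU] : nbhs x U by exact: open_nbhs_nbhs.
  (* the cell of x in the grid of mesh 1 / N.+1 < e is inside the ball *)
  pose N := Num.truncn e^-1.
  have Ne : N.+1%:R^-1 < e.
    by rewrite invf_plt ?posrE// truncnS_gt.
  have N0 : (0 : R) < N.+1%:R by [].
  pose p : I := (N, [ffun i => Num.ceil (x ord0 i * N.+1%:R)]).
  have Bx : B p x.
    move=> i; rewrite !mxE /= ffunE ltr_pdivrMr// ler_pdivlMr//.
    by rewrite ceilB1_lt ceil_ge.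
  have BU : B p `<=` U.
    move=> y By; apply: xeU; split => // i j; rewrite (ord1 i : i = ord0) -ball_normE /ball_ /=.
    have := Bx j; have := By j; rewrite !mxE /= rmorphB /= mulrBl mul1r.
    move=> /andP[y1 y2] /andP[x1 x2].
    apply: le_lt_trans Ne; rewrite ler_distl.
    have close (u v s t : R) : u - v < s -> s <= u -> u - v < t -> t <= u ->
      s - v <= t <= s + v by lra.
    exact: close y1 y2 x1 x2.
  exists (pickle p) => //; rewrite /F pickleK; case: ifPn => //.
  by move/asboolP.
apply: caratheodory_measurable_bigcup => k; rewrite /F.
case: (unpickle k) => [p|]; last exact: caratheodory_measurable_set0.
by case: ifPn => _; [exact: box_caratheodory|exact: caratheodory_measurable_set0].
Qed.

End lebesgue_outer_measure.

(** * The Euclidean norm, and Lipschitz images of sets *)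

Section euclidean_norm.
Context {R : realType} {d : nat}.
Notation T := 'rV[R]_d.
Implicit Types (x y z : T) (k : R).

Definition dotp x y : R := \sum_i x ord0 i * y ord0 i.

Lemma dotpC x y : dotp x y = dotp y x.
Proof. by apply: eq_bigr => i _; rewrite mulrC. Qed.

Lemma dotpDl x y z : dotp (x + y) z = dotp x z + dotp y z.
Proof. by rewrite -big_split; apply: eq_bigr => i _; rewrite mxE mulrDl. Qed.

Lemma dotpDr x y z : dotp z (x + y) = dotp z x + dotp z y.
Proof. by rewrite dotpC dotpDl !(dotpC z). Qed.

Lemma dotpZl k x y : dotp (k *: x) y = k * dotp x y.
Proof. by rewrite mulr_sumr; apply: eq_bigr => i _; rewrite mxE mulrA. Qed.

Lemma dotpZr k x y : dotp x (k *: y) = k * dotp x y.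
Proof. by rewrite dotpC dotpZl dotpC. Qed.

Lemma dotpNl x y : dotp (- x) y = - dotp x y.
Proof. by rewrite -scaleN1r dotpZl mulN1r. Qed.

Lemma dotpNr x y : dotp x (- y) = - dotp x y.
Proof. by rewrite dotpC dotpNl dotpC. Qed.

Definition dotpE := (dotpDl, dotpDr, dotpNl, dotpNr, dotpZl, dotpZr).

Lemma dotp_ge0 x : 0 <= dotp x x.
Proof. by apply: sumr_ge0 => i _; rewrite -expr2 sqr_ge0. Qed.

Lemma enorm_ge0 x : 0 <= enorm x. Proof. exact: sqrtr_ge0. Qed.

Lemma sqr_enorm x : enorm x ^+ 2 = dotp x x.
Proof.
rewrite /enorm sqr_sqrtr; last by apply: sumr_ge0 => i _; rewrite sqr_ge0.
by apply: eq_bigr => i _; rewrite expr2.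
Qed.

Lemma le_enorm x y : (enorm x <= enorm y) = (dotp x x <= dotp y y).
Proof. by rewrite -!sqr_enorm ler_pXn2r// nnegrE enorm_ge0. Qed.

Lemma enormZ k x : enorm (k *: x) = `|k| * enorm x.
Proof.
apply/eqP; rewrite -(eqrXn2 (ltn0Sn 1)) ?mulr_ge0 ?enorm_ge0//.
by rewrite exprMn !sqr_enorm !dotpE mulrA -expr2 real_normK ?num_real.
Qed.

Lemma enormN x : enorm (- x) = enorm x.
Proof. by rewrite -scaleN1r enormZ normrN1 mul1r. Qed.

Lemma enormB x y : enorm (x - y) = enorm (y - x).
Proof. by rewrite -enormN opprB. Qed.

Lemma enorm0 : enorm (0 : T) = 0.
Proof. by rewrite -(scale0r (0 : T)) enormZ normr0 mul0r. Qed.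

Lemma coord_le_enorm x i : `|x ord0 i| <= enorm x.
Proof.
rewrite -(ler_pXn2r (ltn0Sn 1)) ?nnegrE ?enorm_ge0// sqr_enorm.
rewrite real_normK ?num_real// /dotp (bigD1 i)//= -expr2 lerDl.
by apply: sumr_ge0 => j _; rewrite -expr2 sqr_ge0.
Qed.

Lemma enorm_eq0 x : enorm x = 0 -> x = 0.
Proof.
move=> x0; apply/rowP => i; rewrite mxE; apply/eqP.
by rewrite -normr_le0 -x0 coord_le_enorm.
Qed.

(** Cauchy-Schwarz, from the nonnegativity of the squared norm of
    (y . y) x - (x . y) y. *)
Lemma dotp_le_enorm x y : dotp x y <= enorm x * enorm y.
Proof.
apply: (le_trans (ler_norm _)).
rewrite -(ler_pXn2r (ltn0Sn 1)) ?nnegrE ?mulr_ge0 ?enorm_ge0//.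
rewrite exprMn !sqr_enorm real_normK ?num_real//.
have := dotp_ge0 y; rewrite le_eqVlt => /predU1P[y0|y0].
  have -> : y = 0 by apply: enorm_eq0; apply/eqP; rewrite -sqrf_eq0 sqr_enorm -y0.
  by rewrite -(scale0r (0 : T)) !dotpE !mul0r expr0n mulr0.
have := dotp_ge0 (dotp y y *: x - dotp x y *: y).
rewrite !dotpE (dotpC y x).
rewrite (_ : _ + _ = dotp y y * (dotp x x * dotp y y - dotp x y ^+ 2)); last by ring.
by rewrite pmulr_rge0// subr_ge0.
Qed.

Lemma enormD x y : enorm (x + y) <= enorm x + enorm y.
Proof.
rewrite -(ler_pXn2r (ltn0Sn 1)) ?nnegrE ?addr_ge0 ?enorm_ge0//.
rewrite sqrrD !sqr_enorm !dotpE (dotpC y x).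
have := dotp_le_enorm x y; lra.
Qed.

Lemma enorm_triangle x y z : enorm (x - z) <= enorm (x - y) + enorm (y - z).
Proof. by rewrite -[x - z](subrKA y) enormD. Qed.

End euclidean_norm.

Section lipschitz_image.
Context {R : realType} {n : nat}.
Notation T := 'rV[R]_n.+1.
Notation lambda := (@lebesgue_rV R n.+1).
Implicit Types (a b x y : T) (X Y : set T) (r k l : R).

Definition eball x r : set T := [set y | enorm (y - x) < r].

Lemma enorm_le_coord x k :
  (forall i, `|x ord0 i| <= k) -> enorm x <= n.+1%:R * k.
Proof.
move=> xk; have k0 : 0 <= k by apply: le_trans (xk ord0).
rewrite -(ler_pXn2r (ltn0Sn 1)) ?nnegrE ?mulr_ge0 ?enorm_ge0// sqr_enorm.
apply: (@le_trans _ _ (\sum_(i < n.+1) k ^+ 2)).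
  by apply: ler_sum => i _; rewrite -expr2 -real_normK ?num_real// lerXn2r ?nnegrE.
rewrite sumr_const card_ord -[leLHS]mulr_natl exprMn ler_wpM2r ?sqr_ge0//.
by rewrite -natrX ler_nat leq_pmulr.
Qed.

Lemma mx_norm_le_enorm x : `|x| <= enorm x.
Proof.
rewrite [leLHS]mx_normrE; apply/bigmax_leP; split; first exact: enorm_ge0.
by move=> [i j] _ /=; rewrite (ord1 i : i = ord0) coord_le_enorm.
Qed.

Lemma enorm_le_mx_norm x : enorm x <= n.+1%:R * `|x|.
Proof.
apply: enorm_le_coord => i; rewrite [leRHS]mx_normrE.
by apply/bigmax_geP; right; exists (ord0, i).
Qed.

Lemma lipschitz_continuous (g : T -> R) k :
  (forall x y, g x - g y <= k * enorm (x - y)) -> continuous g.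
Proof.
move=> gk x; apply/(@cvgrPdist_lt R R T (nbhs (x : T))) => e e0.
have k0 : 0 < `|k| + 1 by rewrite ltr_wpDl.
have kn : 0 < (`|k| + 1) * n.+1%:R by rewrite mulr_gt0.
apply/nbhs_ballP; exists (((`|k| + 1) * n.+1%:R)^-1 * e) => [|y].
  by rewrite /= mulr_gt0 ?invr_gt0.
rewrite -ball_normE /= ltr_pdivlMl// -mulrA => xy.
apply: le_lt_trans xy.
apply: (@le_trans _ _ ((`|k| + 1) * enorm (x - y))); last first.
  by rewrite ler_pM2l// enorm_le_mx_norm.
have kle : k * enorm (x - y) <= (`|k| + 1) * enorm (x - y).
  by rewrite ler_wpM2r ?enorm_ge0// (le_trans (ler_norm _))// lerDl.
rewrite ler_norml lerNl opprB; apply/andP; split.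
  by apply: le_trans (gk _ _) _; rewrite enormB.
exact: le_trans (gk _ _) _.
Qed.

Lemma open_lt_lipschitz (g : T -> R) k r :
  (forall x y, g x - g y <= k * enorm (x - y)) -> open [set x | g x < r].
Proof.
move=> /lipschitz_continuous gc.
by apply: (@open_comp _ _ g [set s : R | s < r]) => [x _|]; [exact: gc|exact: open_lt].
Qed.

Lemma enormB_lipschitz z x y : enorm (x - z) - enorm (y - z) <= enorm (x - y).
Proof. by rewrite lerBlDr enorm_triangle. Qed.

Lemma open_eball x r : open (eball x r).
Proof.
apply: (@open_lt_lipschitz (fun y => enorm (y - x)) 1) => y z.
by rewrite mul1r enormB_lipschitz.
Qed.

(** Regarding the volume of the image under f as an outer measure of the source
    reduces the Lipschitz bound to an estimate on boxes. With f = id it is the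
    restriction of Lebesgue outer measure to E. *)
Definition image_measure (f : T -> T) (E : set T) X : \bar R :=
  lambda (f @` (X `&` E)).

Section image_measure.
Variables (f : T -> T) (E : set T).

Let image_measure0 : image_measure f E set0 = 0%E.
Proof. by rewrite /image_measure set0I image_set0 outer_measure0. Qed.

Let image_measure_ge0 X : (0 <= image_measure f E X)%E.
Proof. exact: outer_measure_ge0. Qed.

Let le_image_measure :
  {homo image_measure f E : X Y / X `<=` Y >-> (X <= Y)%E}.
Proof.
by move=> X Y XY; apply: le_outer_measure; apply: image_subset; exact: setSI.
Qed.

Let image_measure_sigma_subadditive : sigma_subadditive (image_measure f E).
Proof.
move=> F; rewrite /image_measure setI_bigcupl image_bigcup.
exact: outer_measure_sigma_subadditive.
Qed.

HB.instance Definition _ := isOuterMeasure.Build R T (image_measure f E)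
  image_measure0 image_measure_ge0 le_image_measure
  image_measure_sigma_subadditive.

End image_measure.

Lemma lebesgue_affine_le k (v : T) X : 0 < k ->
  (lambda [set (k *: x + v)%R | x in X] <= (k ^+ n.+1)%:E * lambda X)%E.
Proof.
move=> k0; pose f x := k *: x + v.
have -> : lambda [set k *: x + v | x in X] = image_measure f setT X.
  by rewrite /image_measure setIT.
apply: le_mul_lebesgue_rV => [|a b]; first by rewrite exprn_gt0.
have -> : k ^+ n.+1 * box_volume a b = box_volume (f a) (f b).
  rewrite /box_volume -{1}(card_ord n.+1) -prodr_const -big_split /=.
  apply: eq_bigr => i _; rewrite !mxE maxr_pMr ?ltW// mulr0; congr Num.max.
  by ring.
apply: le_trans (lebesgue_rV_box _ _); apply: le_lebesgue_rV.
move=> _ [x [abx _] <-] i; have /andP[ai bi] := abx i; rewrite !mxE.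
by rewrite ltrD2r lerD2r ltr_pM2l// ler_pM2l// ai bi.
Qed.

Definition unit_ball_volume : R := fine (lambda (eball 0 1)).
Notation omega := unit_ball_volume.

Let unit_ball_le : (lambda (eball 0 1) <= (2 ^+ n.+1)%:E)%E.
Proof.
apply: (@le_trans _ _ (lambda (box (const_mx (-1)) (const_mx 1)))).
  apply: le_lebesgue_rV => x; rewrite /eball /= subr0 => x1 i; rewrite !mxE.
  have := le_lt_trans (coord_le_enorm x i) x1.
  by rewrite ltr_norml => /andP[-> /ltW].
apply: (le_trans (lebesgue_rV_box _ _)); rewrite lee_fin /box_volume.
rewrite (eq_bigr (fun=> 2)) ?prodr_const ?card_ord// => i _.
by rewrite !mxE opprK max_r.
Qed.

Lemma unit_ball_volumeE : lambda (eball 0 1) = omega%:E.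
Proof.
by rewrite fineK// ge0_fin_numE ?outer_measure_ge0// (le_lt_trans unit_ball_le) ?ltry.
Qed.

Lemma unit_ball_volume_le : omega <= 2 ^+ n.+1.
Proof. by rewrite -lee_fin -unit_ball_volumeE. Qed.

Lemma unit_ball_volume_ge0 : 0 <= omega.
Proof. by rewrite fine_ge0 ?outer_measure_ge0. Qed.

Lemma lebesgue_eball x r : 0 < r -> lambda (eball x r) = (omega * r ^+ n.+1)%:E.
Proof.
move=> r0; apply/eqP; rewrite eq_le; apply/andP; split.
  rewrite mulrC EFinM -unit_ball_volumeE.
  apply: le_trans (lebesgue_affine_le x _ r0); apply: le_lebesgue_rV => y xy.
  exists (r^-1 *: (y - x)); last by rewrite scalerA divff ?gt_eqF// scale1r subrK.
  rewrite /eball /= subr0 enormZ gtr0_norm ?invr_gt0//.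
  by rewrite mulrC ltr_pdivrMr// mul1r.
have ri : 0 < r^-1 by rewrite invr_gt0.
rewrite mulrC EFinM -unit_ball_volumeE -lee_pdivlMl ?exprn_gt0// -exprVn.
apply: le_trans (lebesgue_affine_le (- (r^-1 *: x)) _ ri); apply: le_lebesgue_rV => y.
rewrite /eball /= subr0 => y1; exists (r *: y + x).
  by rewrite addrK enormZ gtr0_norm// gtr_pMr.
by rewrite scalerDr scalerA mulVf ?gt_eqF// scale1r addrK.
Qed.

Lemma box_split a b (i : 'I_n.+1) (c : R) :
  box a b `<=` box a (set_coord b i c) `|` box (set_coord a i c) b.
Proof.
move=> x abx; have [xc|xc] := leP (x ord0 i) c; [left|right] => j;
  have /andP[aj bj] := abx j; rewrite ?aj ?bj ?andbT !mxE; by case: eqP => // ->.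
Qed.

Lemma box_volume_split_mid a b (i : 'I_n.+1) (c : R) :
  a ord0 i <= c <= b ord0 i ->
  box_volume a (set_coord b i c) + box_volume (set_coord a i c) b
  = box_volume a b.
Proof.
by move=> /andP[ac cb]; rewrite -(box_volume_split a b i c) min_r ?max_r.
Qed.

(** Any box is cut, slice by slice, into boxes whose sides are all in
    [l, 2 l].  Cutting a slice of thickness l decreases the sum of the sides by
    l, hence the induction. *)
Lemma box_split_ind (P : T -> T -> Prop) l : 0 < l ->
  (forall a b, (forall i, l <= b ord0 i - a ord0 i <= 2 * l) -> P a b) ->
  (forall a b i c, a ord0 i <= c <= b ord0 i ->
     P a (set_coord b i c) -> P (set_coord a i c) b -> P a b) ->
  forall a b, (forall i, l <= b ord0 i - a ord0 i) -> P a b.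
Proof.
move=> l0 Pcube Psplit a b.
pose size_ (a b : T) := \sum_i (b ord0 i - a ord0 i).
have [N] : exists N, size_ a b <= N%:R * l.
  exists (Num.truncn (size_ a b / l)).+1.
  by rewrite -ler_pdivrMr// ltW// truncnS_gt.
elim: N a b => [|N IH] a b sab lab.
  exfalso; move: sab; rewrite mul0r leNgt => /negP; apply.
  rewrite /size_ big_ord_recl ltr_wpDr//; last exact: lt_le_trans (lab _).
  by apply: sumr_ge0 => i _; apply: le_trans (lab _); exact: ltW.
have [/forallP/= ab2|/forallPn/=[i]] :=
  boolP [forall i, b ord0 i - a ord0 i <= 2 * l].
  by apply: Pcube => i; rewrite lab ab2.
rewrite -ltNge => iab.
have sizeE a' b' : (forall j, j != i -> b' ord0 j - a' ord0 j = b ord0 j - a ord0 j) ->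
    size_ a' b' = size_ a b - (b ord0 i - a ord0 i) + (b' ord0 i - a' ord0 i).
  move=> ab'; rewrite /size_ !(bigD1 i (P := xpredT)) //=.
  rewrite (eq_bigr _ ab'); ring.
rewrite -natr1 mulrDl mul1r in sab.
apply: (Psplit _ _ i (a ord0 i + l)); first by apply/andP; split; lra.
- apply: IH => [|j].
    rewrite sizeE => [|j /negbTE ji]; rewrite !mxE ?eqxx ?ji//; lra.
  by rewrite !mxE; case: eqP => [->|_]; [lra|exact: lab].
- apply: IH => [|j].
    rewrite sizeE => [|j /negbTE ji]; rewrite !mxE ?eqxx ?ji//; lra.
  by rewrite !mxE; case: eqP => [->|_]; [lra|exact: lab].
Qed.

(** Cutting a box with the shortest side as unit leaves only boxes of bounded
    eccentricity, which a ball fills up to a fixed proportion. *)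
Lemma le_box_of_near_cubes (m : {outer_measure set T -> \bar R}) (c : R) :
  0 <= c ->
  (forall l a b, 0 < l -> (forall i, l <= b ord0 i - a ord0 i <= 2 * l) ->
     (m (box a b) <= (c * box_volume a b)%:E)%E) ->
  forall a b, (m (box a b) <= (c * box_volume a b)%:E)%E.
Proof.
move=> c0 mcube a b.
have [/forallP/= ab|/forallPn/=[i]] := boolP [forall i, a ord0 i < b ord0 i]; last first.
  rewrite -leNgt => bai; rewrite (_ : box a b = set0) ?outer_measure0.
    by rewrite lee_fin mulr_ge0 ?box_volume_ge0.
  rewrite -subset0 => x /(_ i)/andP[ax xb]; have := lt_le_trans ax xb.
  by rewrite ltNge bai.
have [i _ imin] := @arg_minP _ _ _ ord0 xpredT (fun i => b ord0 i - a ord0 i) isT.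
apply: (@box_split_ind (fun a b => (m (box a b) <= (c * box_volume a b)%:E)%E)
  (b ord0 i - a ord0 i)) => [|a' b' ab'|a' b' j e ej P1 P2|j].
- by rewrite subr_gt0.
- by apply: mcube ab'; rewrite subr_gt0.
- apply: (le_trans (le_outer_measure m _ _ (@box_split a' b' j e))).
  apply: (le_trans (outer_measureU2 m _ _)).
  by rewrite -(box_volume_split_mid ej) mulrDr EFinD leeD.
- exact: imin.
Qed.

Lemma box_volume_ge_near_cube l a b : 0 < l ->
  (forall i, l <= b ord0 i - a ord0 i) -> l ^+ n.+1 <= box_volume a b.
Proof.
move=> l0 ab; have -> : l ^+ n.+1 = \prod_(i < n.+1) l by rewrite prodr_const card_ord.
by apply: ler_prod => i _; rewrite ltW//= le_max ab orbT.
Qed.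

Lemma box_volume_le_near_cube l a b : 0 < l ->
  (forall i, b ord0 i - a ord0 i <= l) -> box_volume a b <= l ^+ n.+1.
Proof.
move=> l0 ab; have -> : l ^+ n.+1 = \prod_(i < n.+1) l by rewrite prodr_const card_ord.
by apply: ler_prod => i _; rewrite le_max lexx/= ge_max ltW//= ab.
Qed.

Section lipschitz.
Variables (f : T -> T) (E : set T) (L : R).
Hypothesis L0 : 0 < L.
Hypothesis fL : forall x y, E x -> E y -> enorm (f x - f y) <= L * enorm (x - y).
Notation m := (image_measure f E).

Let image_ball x y r (s : R) : 0 < s -> E y -> 
  (forall z, eball x r z -> E z -> enorm (z - y) < s) ->
  (m (eball x r) <= (omega * (L * s) ^+ n.+1)%:E)%E.
Proof.
move=> s0 Ey xy; rewrite -(lebesgue_eball (f y)) ?mulr_gt0//.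
apply: le_outer_measure => _ [z [xz Ez] <-]; rewrite /eball /=.
by apply: (le_lt_trans (fL Ez Ey)); rewrite ltr_pM2l// xy.
Qed.

(** The image of a near-cube has a diameter comparable to its side; this bound
    has the wrong constant, and [improve_bound] will sharpen it. *)
Let crude_bound a b : (m (box a b) <=
  (omega * (L * (n.+1%:R * 3)) ^+ n.+1 * box_volume a b)%:E)%E.
Proof.
have C0 : 0 <= omega * (L * (n.+1%:R * 3)) ^+ n.+1 by
  rewrite mulr_ge0 ?unit_ball_volume_ge0 ?exprn_ge0 ?mulr_ge0// ltW.
apply: le_box_of_near_cubes => // l {}a {}b l0 ab.
have [[y [aby Ey]]|noy] := pselect (exists y, box a b y /\ E y); last first.
  apply: (@le_trans _ _ (lambda set0)); last first.
    by rewrite outer_measure0 lee_fin mulr_ge0 ?box_volume_ge0.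
  by apply: le_outer_measure => ? [x [abx Ex] _]; apply: noy; exists x.
apply: (@le_trans _ _ (omega * (L * (n.+1%:R * 3 * l)) ^+ n.+1)%:E).
  rewrite -(lebesgue_eball (f y)) ?mulr_gt0//.
  apply: le_outer_measure => _ [z [abz Ez] <-]; rewrite /eball /=.
  apply: (le_lt_trans (fL Ez Ey)); rewrite ltr_pM2l//.
  apply: (@le_lt_trans _ _ (n.+1%:R * (2 * l))).
    apply: enorm_le_coord => i; rewrite !mxE.
    have := ab i; have /andP[] := abz i; have /andP[] := aby i.
    by rewrite ler_norml; lra.
  by rewrite -mulrA ltr_pM2l// ltr_pM2r// ltr_nat.
rewrite lee_fin (_ : (L * (n.+1%:R * 3 * l)) ^+ n.+1 =
    (L * (n.+1%:R * 3)) ^+ n.+1 * l ^+ n.+1); last by rewrite -exprMn !mulrA.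
rewrite mulrA ler_wpM2l//.
by apply: box_volume_ge_near_cube => // i; have /andP[] := ab i.
Qed.

(** Take a ball inscribed in a near-cube, and shrink it by the factor eta.
    If the small ball meets E at y, the image of the large ball lies in the ball
    around f y whose radius is larger by the factor L (1 + eta), so on the large
    ball the optimal constant holds, and the bound c is used only outside it.
    Otherwise the small ball contributes nothing. In both cases a fixed
    proportion of the volume is gained, unless c is already optimal. *)
Let improve_bound (c eta : R) : 0 < eta < 1 -> (L * (1 + eta)) ^+ n.+1 <= c ->
  (forall a b, m (box a b) <= (c * box_volume a b)%:E)%E ->
  forall a b, (m (box a b) <=
    ((c - (c - (L * (1 + eta)) ^+ n.+1) * (omega * (eta / 4) ^+ n.+1))
       * box_volume a b)%:E)%E.
Proof.
move=> /andP[eta0 eta1]; set K := (_ * _) ^+ _ => Kc mc.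
set theta := omega * _.
have K0 : 0 < K by rewrite exprn_gt0// mulr_gt0// addr_gt0.
have c0 : 0 < c by exact: lt_le_trans Kc.
have theta0 : 0 <= theta.
  by rewrite mulr_ge0 ?unit_ball_volume_ge0 ?exprn_ge0 ?divr_ge0// ltW.
have theta1 : theta <= 1.
  apply: (@le_trans _ _ (2 ^+ n.+1 * (eta / 4) ^+ n.+1)).
    by rewrite ler_wpM2r ?unit_ball_volume_le ?exprn_ge0 ?divr_ge0// ltW.
  rewrite -exprMn exprn_ile1//; lra.
apply: le_box_of_near_cubes => [|l a b l0 ab]; first by nra.
pose x : T := 2^-1 *: (a + b).
pose r := l / 2; have r0 : 0 < r by rewrite divr_gt0.
have etar : 0 < eta * r by rewrite mulr_gt0.
have Bsub s : s <= r -> eball x s `<=` box a b.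
  move=> sr z; rewrite /eball /= => zs i.
  have := le_lt_trans (coord_le_enorm _ i) (lt_le_trans zs sr).
  have := ab i; rewrite !mxE ltr_norml /r; lra.
(* the bound c is used outside the ball of radius s only *)
have out (s : R) : 0 < s -> s <= r ->
    (m (box a b) <= m (eball x s) + (c * (box_volume a b - omega * s ^+ n.+1))%:E)%E.
  move=> s0 sr.
  have -> : m (box a b) = m (eball x s `|` (box a b `&` ~` eball x s)).
    by congr m; rewrite setUIr setUv setIT; apply/esym/setUidPr; exact: Bsub.
  apply: (le_trans (outer_measureU2 _ _ _)); rewrite leeD2l//.
  apply: (le_trans (le_mul_lebesgue_rV _ c0 mc)).
  rewrite EFinM lee_pmul2l ?lte_fin// EFinB leeBrDr// -(lebesgue_eball x)//.
  apply: le_trans (lebesgue_rV_box _ _).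
  rewrite [leRHS](open_caratheodory (@open_eball x s)) addeC leeD2r//.
  by apply: le_outer_measure => z xz; split => //; exact: Bsub xz.
(* r = (2 * l) / 4, and 2 * l bounds the sides of the box *)
have smallE : theta * box_volume a b <= omega * (eta * r) ^+ n.+1.
  rewrite /theta -mulrA ler_wpM2l ?unit_ball_volume_ge0//.
  rewrite (_ : eta * r = eta / 4 * (2 * l)); last by rewrite /r; field.
  rewrite [leRHS]exprMn ler_wpM2l// ?exprn_ge0 ?divr_ge0 ?(ltW eta0)//.
  by apply: box_volume_le_near_cube => [|i]; [rewrite mulr_gt0|have /andP[] := ab i].
have [[y [xy Ey]]|noy] := pselect (exists y, eball x (eta * r) y /\ E y).
  have /le_trans := out r r0 (lexx _); apply.
  apply: (@le_trans _ _ ((omega * (L * ((1 + eta) * r)) ^+ n.+1)%:E +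
      (c * (box_volume a b - omega * r ^+ n.+1))%:E)%E).
    rewrite leeD2r// (@image_ball _ y) ?mulr_gt0 ?addr_gt0// => z xz Ez.
    have := enorm_triangle z x y; move: xy xz; rewrite /eball /= (enormB y); lra.
  rewrite -EFinD lee_fin (mulrA L) exprMn -/K.
  have smallr : (eta * r) ^+ n.+1 <= r ^+ n.+1.
    by rewrite lerXn2r ?nnegrE ?ltW// gtr_pMl.
  have := ler_wpM2l unit_ball_volume_ge0 smallr; move/(le_trans smallE).
  move=> bigE; have cK : 0 <= c - K by rewrite subr_ge0.
  by have := ler_wpM2l cK bigE; lra.
apply: (le_trans (out _ etar _)); first by rewrite ger_pMl// ltW.
apply: (@le_trans _ _ (0 + (c * (box_volume a b - omega * (eta * r) ^+ n.+1))%:E)%E).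
  rewrite leeD2r//; apply: (@le_trans _ _ (lambda set0)).
    by apply: le_outer_measure => ? [z [xz Ez] _]; apply: noy; exists z.
  by rewrite outer_measure0.
rewrite add0e lee_fin; have := ler_wpM2l (ltW c0) smallE.
have := mulr_ge0 (ltW K0) (mulr_ge0 theta0 (box_volume_ge0 a b)); lra.
Qed.

(** The infimum of the admissible constants is admissible, and [improve_bound]
    would make it smaller if it exceeded (L (1 + eta)) ^ d for some eta > 0. *)
Theorem lebesgue_lipschitz_image :
  (lambda (f @` E) <= (L ^+ n.+1)%:E * lambda E)%E.
Proof.
rewrite (_ : lambda _ = m E); last by rewrite /image_measure setIid.
pose S := [set c : R | forall a b, (m (box a b) <= (c * box_volume a b)%:E)%E].
have S0 : S !=set0 by eexists; exact: crude_bound.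
have mfin a b : m (box a b) \is a fin_num.
  rewrite ge0_fin_numE ?outer_measure_ge0//.
  exact: le_lt_trans (crude_bound a b) (ltry _).
have Sbound a b c : S c -> fine (m (box a b)) <= c * box_volume a b.
  by move=> Sc; rewrite -lee_fin fineK.
have lbS : lbound S 0.
  move=> c /(@Sbound (const_mx 0) (const_mx 1)) mc.
  have : 0 <= fine (m (box (const_mx 0 : T) (const_mx 1))).
    by rewrite fine_ge0 ?outer_measure_ge0.
  move=> /le_trans/(_ mc); rewrite pmulr_lge0//.
  apply: (@lt_le_trans _ _ (1 ^+ n.+1)); first by rewrite expr1n.
  by apply: box_volume_ge_near_cube => // i; rewrite !mxE subr0.
have Sinf : S (inf S).
  move=> a b; rewrite -[leLHS]fineK// lee_fin.
  have := box_volume_ge0 a b; rewrite le_eqVlt => /predU1P[v0|v0].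
    by have [c /(@Sbound a b)] := S0; rewrite -v0 !mulr0.
  rewrite -ler_pdivrMr//; apply: lb_le_inf => // c Sc.
  by rewrite ler_pdivrMr// Sbound.
have inf_le : inf S <= L ^+ n.+1.
  (* if balls had volume 0, already the crude bound would be 0 *)
  have := unit_ball_volume_ge0; rewrite le_eqVlt => /predU1P[w0|w0].
    apply: (@le_trans _ _ 0); last by rewrite exprn_ge0// ltW.
    by apply: ge_inf => [|a b]; [exists 0|rewrite (le_trans (crude_bound a b))// -w0 mul0r].
  have cvgK : (L * (1 + eta)) ^+ n.+1 @[eta --> (0 : R)^'+] --> L ^+ n.+1.
    rewrite (_ : L ^+ n.+1 = (L * (1 + 0)) ^+ n.+1); last by rewrite addr0 mulr1.
    apply: cvg_at_right_filter.
    apply: (@continuous_cvg _ _ _ _ _ (fun eta : R => L * (1 + eta))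
      (fun x : R => x ^+ n.+1)); first exact: exprn_continuous.
    by apply: cvgM; [exact: cvg_cst|apply: cvgD; [exact: cvg_cst|exact: cvg_id]].
  apply: (cvgr_to_ge cvgK); near=> eta.
  have eta01 : 0 < eta < 1.
    by apply/andP; split; near: eta; [exact: nbhs_right_gt|exact: nbhs_right_lt].
  have [//|infK] := leP (inf S) ((L * (1 + eta)) ^+ n.+1).
  have lbS' : has_lbound S by exists 0.
  have := @ge_inf _ S lbS' _ (improve_bound eta01 (ltW infK) Sinf).
  rewrite -subr_ge0 addrAC subrr add0r oppr_ge0.
  have theta0 : 0 < omega * (eta / 4) ^+ n.+1.
    by case/andP: eta01 => eta0 _; rewrite mulr_gt0// exprn_gt0// divr_gt0.
  by rewrite (pmulr_lle0 _ theta0) subr_le0 leNgt infK.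
apply: le_mul_lebesgue_rV => [|a b]; first by rewrite exprn_gt0.
apply: (le_trans (Sinf a b)); rewrite lee_fin.
by rewrite ler_wpM2r ?box_volume_ge0.
Unshelve. all: by end_near. Qed.

End lipschitz.
End lipschitz_image.

(** * The distance to a closed set, and contraction towards the foot *)

Section distance.
Context {R : realType} {n : nat}.
Notation T := 'rV[R]_n.+1.
Implicit Types (x y z a : T) (A C : set T) (r t : R).

Lemma parallel_setP C t z :
  parallel_set C t z <-> exists2 c, C c & enorm (z - c) < t.
Proof.
split=> [/ereal_inf_lt[_ [c Cc <-]]|[c Cc zc]].
  by rewrite lte_fin => zc; exists c.
apply: (@le_lt_trans _ _ (enorm (z - c))%:E); last by rewrite lte_fin.
by apply: ereal_inf_lbound; exists c.
Qed.

Variable A : set T.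
Hypothesis A0 : A !=set0.

Definition rdist z : R := fine (dist_set z A).

Lemma rdistE z : dist_set z A = (rdist z)%:E.
Proof.
have [a Aa] := A0; rewrite fineK// ge0_fin_numE.
  apply: (@le_lt_trans _ _ (enorm (z - a))%:E); last exact: ltry.
  by apply: ereal_inf_lbound; exists a.
by apply: le_ereal_inf_tmp => _ [c _ <-]; rewrite lee_fin enorm_ge0.
Qed.

Lemma parallel_rdist t z : parallel_set A t z = (rdist z < t) :> Prop.
Proof. by rewrite /parallel_set /= rdistE lte_fin. Qed.

Lemma rdist_le z a : A a -> rdist z <= enorm (z - a).
Proof.
by move=> Aa; rewrite -lee_fin -rdistE; apply: ereal_inf_lbound; exists a.
Qed.

Lemma rdist_lt z t : rdist z < t -> exists2 a, A a & enorm (z - a) < t.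
Proof. by move=> zt; apply/parallel_setP; rewrite parallel_rdist. Qed.

Lemma rdist_lipschitz x y : rdist x - rdist y <= enorm (x - y).
Proof.
rewrite lerBlDr; apply/ler_addgt0Pr => e e0.
have [a Aa ya] : exists2 a, A a & enorm (y - a) < rdist y + e.
  by apply: rdist_lt; rewrite ltrDl.
apply: (le_trans (rdist_le x Aa)); apply: (le_trans (enorm_triangle x y a)).
by rewrite -addrA lerD2l ltW.
Qed.

Lemma open_parallel_set t : open (parallel_set A t).
Proof.
rewrite (_ : parallel_set A t = [set z | rdist z < t]).
  by apply: (@open_lt_lipschitz _ _ _ 1) => x y; rewrite mul1r rdist_lipschitz.
by apply/funext => z; rewrite parallel_rdist.
Qed.

Lemma rdist_nearest z a : closed A -> nearest A z a -> A a /\ rdist z = enorm (z - a).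
Proof.
move=> cA [+ amin]; rewrite -(closure_id A).1// => Aa; split => //.
apply/eqP; rewrite eq_le rdist_le//= leNgt; apply/negP => /rdist_lt[b Ab].
by rewrite ltNge amin//; exact: subset_closure.
Qed.

End distance.

Section contraction.
Context {R : realType} {n : nat}.
Notation T := 'rV[R]_n.+1.
Notation lambda := (@lebesgue_rV R n.+1).
Variable A : set T.
Hypothesis cA : closed A.
Hypothesis A0 : A !=set0.
Notation pi := (metric_proj A).
Notation dA := (rdist A).
Implicit Types (x y z : T) (B : set T) (k : R).

Lemma metric_proj_nearest z : Unp A z -> nearest A z (pi z).
Proof. by move=> [a [za _]]; apply: (@getPex _ (nearest A z)); exists a. Qed.

Lemma metric_proj_eq z a : Unp A z -> nearest A z a -> pi z = a.
Proof.
by move=> [b [zb bu]] za; rewrite -(bu _ za); apply/esym/bu/metric_proj_nearest; exists b.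
Qed.

Lemma metric_proj_in z : Unp A z -> A (pi z).
Proof. by move=> /metric_proj_nearest/(rdist_nearest A0 cA)[]. Qed.

Lemma rdist_metric_proj z : Unp A z -> dA z = enorm (z - pi z).
Proof. by move=> /metric_proj_nearest/(rdist_nearest A0 cA)[]. Qed.

Definition shrink k z : T := pi z + k^-1 *: (z - pi z).

Section shrink.
Variable k : R.
Hypothesis k1 : 1 <= k.
Let k0 : 0 < k. Proof. exact: lt_le_trans k1. Qed.
Let kV1 : k^-1 <= 1. Proof. by rewrite invf_le1. Qed.

Lemma enorm_shrink_proj z : Unp A z -> enorm (shrink k z - pi z) = dA z / k.
Proof.
move=> Uz; rewrite /shrink addrC addKr enormZ gtr0_norm ?invr_gt0//.
by rewrite -rdist_metric_proj// mulrC.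
Qed.

Lemma enormB_shrink z : Unp A z -> enorm (z - shrink k z) = dA z - dA z / k.
Proof.
move=> Uz; rewrite (_ : z - _ = (1 - k^-1) *: (z - pi z)).
  by rewrite enormZ ger0_norm ?subr_ge0// -rdist_metric_proj//; ring.
by rewrite /shrink scalerBl scale1r opprD addrA.
Qed.

(** If a is at least as close to the shrunk point as the foot of z, then the
    triangle inequality makes a a nearest point of z. *)
Lemma nearest_shrink z a : Unp A z -> nearest A (shrink k z) a <-> a = pi z.
Proof.
move=> Uz; have [_ pimin] := metric_proj_nearest Uz.
have far b : closure A b -> dA z <= enorm (z - b).
  by move=> Ab; rewrite rdist_metric_proj// pimin.
split=> [[Aa amin]|->].
  apply/esym/metric_proj_eq => //; split => // b Ab; apply: le_trans (far _ Ab).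
  have := amin _ (subset_closure (metric_proj_in Uz)).
  rewrite enorm_shrink_proj//.
  have := enorm_triangle z (shrink k z) a; rewrite enormB_shrink//; lra.
split=> [|b Ab]; first exact/subset_closure/metric_proj_in.
rewrite enorm_shrink_proj//; have := far _ Ab.
have := enorm_triangle z (shrink k z) b; rewrite enormB_shrink//; lra.
Qed.

Lemma Unp_shrink z : Unp A z -> Unp A (shrink k z).
Proof.
move=> Uz; exists (pi z); split; first exact/(nearest_shrink _ Uz).
by move=> a /(nearest_shrink _ Uz).
Qed.

Lemma metric_proj_shrink z : Unp A z -> pi (shrink k z) = pi z.
Proof.
move=> Uz; apply: metric_proj_eq; first exact: Unp_shrink.
exact/(nearest_shrink _ Uz).
Qed.

Lemma rdist_shrink z : Unp A z -> dA (shrink k z) = dA z / k.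
Proof.
move=> Uz; rewrite rdist_metric_proj; last exact: Unp_shrink.
by rewrite metric_proj_shrink// enorm_shrink_proj.
Qed.

Lemma metric_proj_preimage_shrink B z :
  metric_proj_preimage A B z -> metric_proj_preimage A B (shrink k z).
Proof.
by move=> [Uz Bz]; split; [exact: Unp_shrink|rewrite /= metric_proj_shrink].
Qed.

(** Let w be the difference of the feet and s that of the vectors from the feet
    to the points. Since each foot is nearest to its own point, adding the two
    inequalities gives w . s + |w|^2 >= 0, and then
    |k w + s|^2 - |w + s|^2 = 2 (k - 1) (w . s + |w|^2) + (k - 1)^2 |w|^2. *)
Lemma shrink_expands x y : Unp A x -> Unp A y ->
  enorm (x - y) <= k * enorm (shrink k x - shrink k y).
Proof.
move=> Ux Uy.
have [w wE] : exists w, w = pi x - pi y by eexists.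
have [s sE] : exists s, s = (x - pi x) - (y - pi y) by eexists.
have xy : x - y = w + s.
  by rewrite wE sE; apply/rowP => i; rewrite !mxE; ring.
have cxy : k *: (shrink k x - shrink k y) = k *: w + s.
  by rewrite wE sE /shrink; apply/rowP => i; rewrite !mxE; field; rewrite gt_eqF.
rewrite (_ : k * _ = enorm (k *: (shrink k x - shrink k y))); last first.
  by rewrite enormZ gtr0_norm.
rewrite cxy xy le_enorm !dotpE.
have ws : 0 <= dotp w s + dotp w w.
  have [_ xmin] := metric_proj_nearest Ux; have [_ ymin] := metric_proj_nearest Uy.
  have := xmin _ (subset_closure (metric_proj_in Uy)).
  have := ymin _ (subset_closure (metric_proj_in Ux)).
  rewrite !le_enorm.
  have -> : x - pi y = (x - pi x) + w.
    by rewrite wE; apply/rowP => i; rewrite !mxE; ring.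
  have -> : y - pi x = (y - pi y) - w.
    by rewrite wE; apply/rowP => i; rewrite !mxE; ring.
  rewrite sE; move: (x - pi x) (y - pi y) => u v; rewrite !dotpE.
  rewrite (dotpC u w) (dotpC v w); lra.
have k1' : 0 <= k - 1 by rewrite subr_ge0.
have := mulr_ge0 k1' ws; have := mulr_ge0 (sqr_ge0 (k - 1)) (dotp_ge0 w).
rewrite (dotpC s w); move: (dotp w w) (dotp w s) (dotp s s) => ww {}ws ss; lra.
Qed.

Lemma lebesgue_shrink (Z E : set T) : Z `<=` Unp A ->
  (forall z, Z z -> E (shrink k z)) ->
  (lambda Z <= (k ^+ n.+1)%:E * lambda E)%E.
Proof.
move=> ZU ZE; pose g z := pi z + k *: (z - pi z).
have gK z : Z z -> g (shrink k z) = z.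
  move=> Zz; rewrite /g metric_proj_shrink; last exact: ZU.
  rewrite /shrink.
  by apply/rowP => i; rewrite !mxE; field; rewrite gt_eqF.
have Zg : Z `<=` g @` (shrink k @` Z).
  by move=> z Zz; exists (shrink k z); [exists z|exact: gK].
apply: (le_trans (le_outer_measure lambda _ _ Zg)).
apply: (@le_trans _ _ ((k ^+ n.+1)%:E * lambda (shrink k @` Z))%E).
  apply: lebesgue_lipschitz_image => // _ _ [x Zx <-] [y Zy <-].
  by rewrite !gK// shrink_expands//; exact: ZU.
rewrite lee_wpmul2l ?lee_fin ?exprn_ge0 ?(ltW k0)//.
by apply: le_outer_measure => _ [z Zz <-]; exact: ZE.
Qed.

End shrink.

Definition slice_volume (X : set T) r : R := fine (lambda (parallel_set A r `&` X)).

Section slices.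
Variable B : set T.
Notation Y := (metric_proj_preimage A B).
Hypothesis finV : exists2 r : R, 0 < r & (lambda (parallel_set A r `&` Y) < +oo)%E.

(** If r > s, shrinking by k = r / s carries the parallel set of radius r into
    the one of radius s. *)
Lemma local_volume_finite r : (lambda (parallel_set A r `&` Y) < +oo)%E.
Proof.
have [s s0 sfin] := finV; pose k := Num.max 1 (r / s).
have k1 : 1 <= k by rewrite le_max lexx.
have k0 : 0 < k by exact: lt_le_trans k1.
apply: (@le_lt_trans _ _ ((k ^+ n.+1)%:E * lambda (parallel_set A s `&` Y))%E).
  apply: (lebesgue_shrink k1) => [z [_ []] //|z [zr Yz]].
  split; last exact: metric_proj_preimage_shrink.
  move: zr; rewrite !parallel_rdist// rdist_shrink//; last by case: Yz.
  rewrite ltr_pdivrMr// => /lt_le_trans; apply.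
  by rewrite -ler_pdivrMl// mulrC le_max lexx orbT.
by rewrite lte_mul_pinfty ?lee_fin ?exprn_ge0// ltW.
Qed.

Variable X : set T.
Hypothesis XY : X `<=` Y.

Let slice_fin r : lambda (parallel_set A r `&` X) \is a fin_num.
Proof.
rewrite ge0_fin_numE ?outer_measure_ge0// (le_lt_trans _ (local_volume_finite r))//.
by apply: le_outer_measure; exact: setIS.
Qed.

Lemma slice_volumeE r : lambda (parallel_set A r `&` X) = (slice_volume X r)%:E.
Proof. by rewrite fineK. Qed.

Lemma slice_volume_le a b : a <= b -> slice_volume X a <= slice_volume X b.
Proof.
move=> ab; rewrite -lee_fin -!slice_volumeE; apply: le_outer_measure.
by apply: setSI => z; rewrite !parallel_rdist// => /lt_le_trans; apply.
Qed.

Lemma shell_volume a b : a <= b ->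
  lambda ([set z | a <= dA z < b] `&` X) =
  (slice_volume X b - slice_volume X a)%:E.
Proof.
move=> ab; rewrite EFinB -!slice_volumeE.
rewrite (open_caratheodory (@open_parallel_set _ _ _ A0 a) (parallel_set A b `&` X)).
have -> : parallel_set A b `&` X `&` parallel_set A a = parallel_set A a `&` X.
  apply/seteqP; split=> z [] => [[_ ? ?]//|az Xz]; do !split => //.
  by move: az; rewrite !parallel_rdist// => /lt_le_trans; apply.
rewrite addeAC subee ?slice_fin// add0e; congr lambda.
apply/seteqP; split=> z /=.
  move=> [/andP[az zb] Xz]; rewrite !parallel_rdist//; do !split => //.
  by apply/negP; rewrite -leNgt.
by rewrite !parallel_rdist// => -[[zb Xz] /negP]; rewrite -leNgt zb => ->.
Qed.

End slices.

(** The source of all volume estimates below: with O the whole space it is the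
    Kneser inequality, and with O a set of points whose ray extends it bounds
    the volume of that set from below. *)
Lemma shell_volume_shrink (B O : set T) a b k :
  (exists2 r : R, 0 < r & (lambda (parallel_set A r `&` metric_proj_preimage A B) < +oo)%E) ->
  1 <= k -> a <= b ->
  (forall z, metric_proj_preimage A B z -> k * a <= dA z < k * b -> O (shrink k z)) ->
  slice_volume (metric_proj_preimage A B) (k * b) -
  slice_volume (metric_proj_preimage A B) (k * a) <=
  k ^+ n.+1 * (slice_volume (metric_proj_preimage A B `&` O) b -
               slice_volume (metric_proj_preimage A B `&` O) a).
Proof.
move=> finV k1 ab YO; have k0 : 0 < k by exact: lt_le_trans k1.
rewrite -lee_fin -(shell_volume finV) ?ler_pM2l//.
rewrite EFinM -(shell_volume finV)//.
apply: (lebesgue_shrink k1) => [z [_ []] //|z [/andP[az zb] Yz]]; split.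
  rewrite /= rdist_shrink//; last by case: Yz.
  by rewrite ler_pdivlMr// ltr_pdivrMr// ![_ * k]mulrC az zb.
by split; [exact: metric_proj_preimage_shrink|apply: YO => //; apply/andP].
Qed.

End contraction.

(** * Continuity from above, and the boundary of a parallel set *)

Lemma cvg_outer_measure_bigcap (R : realType) (T : pointedType)
    (mu : {outer_measure set T -> \bar R}) (F : (set T)^nat) :
  (forall i, mu.-caratheodory (F i)) ->
  {homo F : i j / (i <= j)%N >-> (j <= i)%O} ->
  (mu (F 0%N) < +oo)%E ->
  mu (F i) @[i --> \oo] --> mu (\bigcap_i F i).
Proof.
move=> mF dF F0; pose U := caratheodory_type mu.
apply: (@nonincreasing_cvg_mu _ U R (mu : set U -> _) F) => //.
by apply: bigcapT_measurable => i; exact: mF.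
Qed.

Section lebesgue_bigcap.
Context {R : realType} {n : nat}.
Notation T := 'rV[R]_n.+1.
Notation lambda := (@lebesgue_rV R n.+1).

(** The set Y is arbitrary: Caratheodory sets are also Caratheodory sets for the
    outer measure restricted to Y. *)
Lemma cvg_lebesgue_rV_bigcap (Y : set T) (F : (set T)^nat) :
  (forall i, lambda.-caratheodory (F i)) ->
  {homo F : i j / (i <= j)%N >-> (j <= i)%O} ->
  (lambda (F 0%N `&` Y) < +oo)%E ->
  lambda (F i `&` Y) @[i --> \oo] --> lambda ((\bigcap_i F i) `&` Y).
Proof.
move=> mF dF F0.
have idE X : lambda (X `&` Y) = image_measure id Y X.
  by rewrite /image_measure image_id.
have mY X : lambda.-caratheodory X -> (image_measure id Y).-caratheodory X.
  move=> mX Z; rewrite /image_measure !image_id (mX (Z `&` Y)).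
  by rewrite (setIAC Z Y X) (setIAC Z Y).
rewrite idE; under eq_fun do rewrite idE.
apply: cvg_outer_measure_bigcap => // [i|]; [exact: mY|by move: F0; rewrite idE].
Qed.

End lebesgue_bigcap.

Section boundary.
Context {R : realType} {n : nat}.
Notation T := 'rV[R]_n.+1.
Notation lambda := (@lebesgue_rV R n.+1).
Notation d := n.+1.
Variable A : set T.
Hypothesis A0 : A !=set0.
Notation dA := (rdist A).
Implicit Types (x y z : T) (r s t a : R).

Lemma rdist_continuous : continuous dA.
Proof.
by apply: (@lipschitz_continuous _ _ _ 1) => x y; rewrite mul1r rdist_lipschitz.
Qed.

Lemma rdist_boundary r z : boundary (parallel_set A r) z -> dA z = r.
Proof.
move=> [zcl znin]; apply/eqP; rewrite eq_le; apply/andP; split.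
  have cl : closed [set y | dA y <= r].
    by apply: (@closed_comp _ _ dA [set s | s <= r]) => [y _|];
      [exact: rdist_continuous|exact: closed_le].
  apply: cl; apply: closure_subset zcl => y; rewrite parallel_rdist//.
  exact: ltW.
rewrite leNgt; apply/negP => zr; apply: znin.
by apply: open_nbhs_nbhs; split; [exact: open_parallel_set|rewrite parallel_rdist].
Qed.

(** A point at distance r > 0 is approached by points closer to A: move it by a
    small proportion tau towards an almost nearest point of A. *)
Lemma boundary_of_rdist r z : 0 < r -> dA z = r -> boundary (parallel_set A r) z.
Proof.
move=> r0 zr; split; last first.
  by move=> /interior_subset; rewrite parallel_rdist// zr ltxx.
move=> B /nbhs_ballP[e /= e0 zB].
(* then (1 - tau) (1 + tau) r < r, and tau (1 + tau) r < e *)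
pose tau := Num.min (1 / 2) (e / (2 * r)).
have tau0 : 0 < tau by rewrite lt_min !divr_gt0 ?mulr_gt0.
have tau2 : tau <= 1 / 2 by rewrite ge_min lexx.
have taue : tau * (2 * r) <= e.
  by rewrite -ler_pdivlMr ?mulr_gt0// ge_min lexx orbT.
have [a Aa za] : exists2 a, A a & enorm (z - a) < r + tau * r.
  by apply: rdist_lt; rewrite // zr ltrDl mulr_gt0.
pose y := z - tau *: (z - a).
exists y; split; last first.
  apply: zB; rewrite -ball_normE /ball_ /=; apply: le_lt_trans (mx_norm_le_enorm _) _.
  rewrite /y opprB addrC subrK enormZ gtr0_norm//.
  have := enorm_ge0 (z - a); nra.
rewrite parallel_rdist//; apply: (le_lt_trans (rdist_le A0 _ Aa)).
have -> : y - a = (1 - tau) *: (z - a).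
  by rewrite /y; apply/rowP => i; rewrite !mxE; ring.
rewrite enormZ ger0_norm; last by lra.
have := enorm_ge0 (z - a); nra.
Qed.

(** By the intermediate value theorem, d_A takes the value r on the segment from
    z to y. *)
Lemma near_boundary_of_crossing r t z y : 0 < r ->
  dA z <= r <= dA y -> enorm (z - y) < t ->
  parallel_set (boundary (parallel_set A r)) t z.
Proof.
move=> r0 /andP[zr ry] zyt; pose g (tau : R) := dA (z + tau *: (y - z)).
have gc : continuous g.
  move=> tau; apply: (@continuous_comp _ _ _ (fun tau : R => z + tau *: (y - z)) dA).
    apply: cvgD; first exact: cvg_cst.
    by apply: cvgZr_tmp; exact: cvg_id.
  exact: rdist_continuous.
have g0 : g 0 = dA z by rewrite /g scale0r addr0.
have g1 : g 1 = dA y by rewrite /g scale1r addrC subrK.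
have [||tau] := @IVT _ g 0 1 r ler01.
- exact: continuous_subspaceT.
- by rewrite g0 g1 ge_min zr le_max ry orbT.
rewrite in_itv /= => /andP[tau0 tau1] gr.
apply/parallel_setP; exists (z + tau *: (y - z)); first exact: boundary_of_rdist.
rewrite opprD addNKr enormN enormZ ger0_norm// enormB.
by apply: le_lt_trans zyt; rewrite ler_piMl ?enorm_ge0.
Qed.

End boundary.

(** * Kneser functions *)

Section powers.
Context {R : realType}.
Implicit Types (q x r t : R) (n : nat).

Lemma bernoulli_ineq q N : 1 <= q -> 1 + N%:R * (q - 1) <= q ^+ N.
Proof.
move=> q1; elim: N => [|N IH]; first by rewrite mul0r addr0 expr0.
rewrite exprS -natr1 mulrDl mul1r.
have : q * (1 + N%:R * (q - 1)) <= q * q ^+ N by rewrite ler_pM2l// (lt_le_trans _ q1).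
have : 0 <= N%:R * ((q - 1) * (q - 1)) by rewrite mulr_ge0// mulr_ge0// subr_ge0.
lra.
Qed.

Lemma exists_expr_between q x : 1 < q -> 1 <= x ->
  exists N, q ^+ N <= x < q ^+ N.+1.
Proof.
move=> q1 x1; have q0 : 0 < q - 1 by rewrite subr_gt0.
have [N xN Nmin] : {N | x < q ^+ N & forall M, x < q ^+ M -> (N <= M)%N}.
  have : exists N, x < q ^+ N.
    exists (Num.truncn (x / (q - 1))).+1.
    apply: lt_le_trans (bernoulli_ineq _ (ltW q1)).
    rewrite -ltrBlDl -ltr_pdivrMr//; apply: le_lt_trans (truncnS_gt _).
    by rewrite ler_wpM2r ?invr_ge0 ?(ltW q0)// gerBl.
  by move=> /ex_minnP[N xN Nmin]; exists N.
case: N xN Nmin => [|N] xN Nmin; first by move: xN; rewrite expr0 ltNge x1.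
exists N; rewrite xN andbT leNgt; apply/negP => /Nmin; by rewrite ltnn.
Qed.

Lemma cvg_expr_affine (u w : R) n :
  (u + w * t) ^+ n @[t --> (0 : R)^'+] --> u ^+ n.
Proof.
rewrite (_ : u ^+ n = (u + w * 0) ^+ n); last by rewrite mulr0 addr0.
apply: cvg_at_right_filter.
apply: (@continuous_cvg _ _ _ _ _ (fun t : R => u + w * t)
  (fun x : R => x ^+ n)); first exact: exprn_continuous.
by apply: cvgD; [exact: cvg_cst|apply: cvgM; [exact: cvg_cst|exact: cvg_id]].
Qed.

Lemma cvg_exprB_quotient (e : R) r n : e != 0 ->
  ((r + e * t) ^+ n.+1 - r ^+ n.+1) / (e * t) @[t --> 0^'+] --> n.+1%:R * r ^+ n.
Proof.
move=> e0; pose S t := \sum_(i < n.+1) (r + e * t) ^+ (n - i) * r ^+ i.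
have S0 : S 0 = n.+1%:R * r ^+ n.
  rewrite /S mulr0 addr0 (eq_bigr (fun=> r ^+ n)) => [|i _].
    by rewrite sumr_const card_ord mulr_natl.
  by rewrite -exprD subnK// -ltnS.
have cS : S t @[t --> 0^'+] --> n.+1%:R * r ^+ n.
  rewrite -S0 /S; apply: (cvg_big add_continuous) => i _.
  rewrite mulr0 addr0; apply: cvgM; [exact: cvg_expr_affine|exact: cvg_cst].
apply: cvg_trans cS; apply: near_eq_cvg; near=> t.
have t0 : t != 0 by rewrite gt_eqF//; near: t; exact: nbhs_right_gt.
have et0 : e * t != 0 by rewrite mulf_neq0.
by rewrite subrXX /S addrAC subrr add0r mulrAC divff// mul1r.
Unshelve. all: by end_near. Qed.

End powers.

Section kneser.
Context {R : realType}.
Variables (n : nat) (v : R -> R).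
Notation d := n.+1.
Hypothesis v_le : forall a b, a <= b -> v a <= v b.
Hypothesis kneser : forall k a b, 1 <= k -> 0 < a -> a <= b ->
  v (k * b) - v (k * a) <= k ^+ d * (v b - v a).
Implicit Types (a b c q r s t : R).

(** Each shell from b q ^ i to b q ^ i.+1 is compared with the shell from b / q to
    b; the differences of d-th powers scale by the same factor. *)
Let kneser_geometric_up q b N : 1 < q -> 0 < b ->
  (v (b * q ^+ N) - v b) * (b ^+ d - (b / q) ^+ d) <=
  (v b - v (b / q)) * ((b * q ^+ N) ^+ d - b ^+ d).
Proof.
move=> q1 b0; have q0 : 0 < q by exact: lt_trans q1.
elim: N => [|N IH]; first by rewrite expr0 mulr1 !subrr mul0r mulr0.
have P0 : 0 <= b ^+ d - (b / q) ^+ d.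
  rewrite subr_ge0 lerXn2r ?nnegrE ?divr_ge0 ?ltW//.
  by rewrite ltr_pdivrMr// ltr_pMr.
have bq : b / q <= b by rewrite ler_pdivrMr// ler_peMr// ltW.
have qN1 : 1 <= q ^+ N.+1 by rewrite exprn_ege1// ltW.
have := ler_wpM2r P0 (kneser qN1 (divr_gt0 b0 q0) bq).
rewrite [q ^+ N.+1 * b]mulrC (_ : q ^+ N.+1 * (b / q) = b * q ^+ N); last first.
  by rewrite exprS; field; rewrite gt_eqF.
have -> : (b * q ^+ N.+1) ^+ d =
    (b * q ^+ N) ^+ d + (q ^+ N.+1) ^+ d * (b ^+ d - (b / q) ^+ d).
  rewrite mulrBr -!exprMn [q ^+ N.+1 * b]mulrC (_ : q ^+ N.+1 * (b / q) = b * q ^+ N).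
    by rewrite addrC subrK.
  by rewrite exprS; field; rewrite gt_eqF.
move: IH; move: (v _) (v _) (v _) (v _) => v1 v2 v3 v4; lra.
Qed.

Let kneser_geometric_down q b N : 1 < q -> 0 < b ->
  (v b - v (b / q)) * (b ^+ d - (b / q ^+ N) ^+ d) <=
  (v b - v (b / q ^+ N)) * (b ^+ d - (b / q) ^+ d).
Proof.
move=> q1 b0; have q0 : 0 < q by exact: lt_trans q1.
elim: N => [|N IH]; first by rewrite expr0 divr1 !subrr mul0r mulr0.
have qN0 : 0 < q ^+ N by rewrite exprn_gt0.
have P0 : 0 <= (b ^+ d - (b / q) ^+ d) / (q ^+ N) ^+ d.
  rewrite divr_ge0 ?exprn_ge0 ?(ltW q0)//.
  rewrite subr_ge0 lerXn2r ?nnegrE ?divr_ge0 ?ltW//.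
  by rewrite ltr_pdivrMr// ltr_pMr.
have bq : b / q ^+ N.+1 <= b / q ^+ N.
  by rewrite ler_pM2l// lef_pV2 ?posrE ?exprn_gt0// ler_weXn2l// ltW.
have qN1 : 1 <= q ^+ N by rewrite exprn_ege1// ltW.
have bqN0 : 0 < b / q ^+ N.+1 by rewrite divr_gt0// exprn_gt0.
have := ler_wpM2r P0 (kneser qN1 bqN0 bq).
rewrite (_ : q ^+ N * (b / q ^+ N.+1) = b / q); last first.
  by rewrite exprS; field; rewrite !gt_eqF.
rewrite (_ : q ^+ N * (b / q ^+ N) = b); last by field; rewrite gt_eqF.
have -> : (b / q ^+ N.+1) ^+ d =
    (b / q ^+ N) ^+ d - (b ^+ d - (b / q) ^+ d) / (q ^+ N) ^+ d.
  rewrite mulrBl -!expr_div_n (_ : b / q / q ^+ N = b / q ^+ N.+1).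
    by rewrite opprB addrC subrK.
  by rewrite exprS; field; rewrite !gt_eqF.
move: IH; rewrite (_ : (q ^+ N) ^+ d * _ * _ =
  (v (b / q ^+ N) - v (b / q ^+ N.+1)) * (b ^+ d - (b / q) ^+ d)); last first.
  by field; rewrite expf_neq0// gt_eqF.
move: (v _) (v _) (v _) (v _) => v1 v2 v3 v4; lra.
Qed.

(** The chord slope of v with respect to r ^ d is smaller on [b, c] than on
    [a, b]: along a geometric progression of ratio q through b it is compared
    with the slope D / P on [b / q, b]. The end points a and c are missed by a
    factor at most q, and q tends to 1. *)
Lemma kneser_concave a b c : 0 < a -> a < b -> b < c ->
  (v c - v b) * (b ^+ d - a ^+ d) <= (v b - v a) * (c ^+ d - b ^+ d).
Proof.
move=> a0 ab bc; have b0 : 0 < b by exact: lt_trans ab.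
have c0 : 0 < c by exact: lt_trans bc.
have approx q : 1 < q -> a * q < b ->
    (v c - v b) * (b ^+ d - (a * q) ^+ d) <= (v b - v a) * ((c * q) ^+ d - b ^+ d).
  move=> q1 aqb; have q0 : 0 < q by exact: lt_trans q1.
  have [N /andP[Nc cN]] : exists N, q ^+ N <= c / b < q ^+ N.+1.
    by apply: exists_expr_between => //; rewrite ler_pdivlMr// mul1r ltW.
  have [M /andP[Mb bM]] : exists M, q ^+ M <= b / a < q ^+ M.+1.
    by apply: exists_expr_between => //; rewrite ler_pdivlMr// mul1r ltW.
  pose P := b ^+ d - (b / q) ^+ d; pose D := v b - v (b / q).
  have P0 : 0 < P.
    by rewrite subr_gt0 ltrXn2r ?nnegrE ?divr_ge0 ?ltW// ltr_pdivrMr// ltr_pMr.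
  have D0 : 0 <= D by rewrite subr_ge0 v_le// ler_pdivrMr// ler_peMr// ltW.
  have up : (v c - v b) * P <= D * ((c * q) ^+ d - b ^+ d).
    apply: (@le_trans _ _ ((v (b * q ^+ N.+1) - v b) * P)).
      by rewrite ler_pM2r// lerD2r v_le// -ler_pdivrMl// mulrC ltW.
    apply: (le_trans (kneser_geometric_up _ q1 b0)).
    rewrite ler_wpM2l// lerD2r lerXn2r ?nnegrE ?mulr_ge0 ?exprn_ge0 ?(ltW b0) ?(ltW c0) ?(ltW q0)//.
    by rewrite exprSr mulrA ler_pM2r// mulrC -ler_pdivlMr.
  have down : D * (b ^+ d - (a * q) ^+ d) <= (v b - v a) * P.
    apply: (@le_trans _ _ ((v b - v (b / q ^+ M)) * P)); last first.
      rewrite ler_pM2r// lerD2l lerN2 v_le// ler_pdivlMr ?exprn_gt0//.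
      by rewrite mulrC -ler_pdivlMr.
    apply: le_trans (kneser_geometric_down _ q1 b0).
    rewrite ler_wpM2l// lerD2l lerN2 lerXn2r ?nnegrE ?divr_ge0 ?mulr_ge0 ?exprn_ge0 ?(ltW b0) ?(ltW a0) ?(ltW q0)//.
    rewrite ler_pdivrMr ?exprn_gt0// -mulrA -exprS mulrC -ler_pdivrMr//.
    exact: ltW.
  have aq0 : 0 <= b ^+ d - (a * q) ^+ d.
    by rewrite subr_ge0 lerXn2r ?nnegrE ?mulr_ge0 ?ltW.
  have cq0 : 0 <= (c * q) ^+ d - b ^+ d.
    rewrite subr_ge0 lerXn2r ?nnegrE ?mulr_ge0 ?(ltW b0) ?(ltW c0) ?(ltW q0)//.
    by rewrite (le_trans (ltW bc))// ler_peMr ?(ltW c0)// ltW.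
  rewrite -(ler_pM2r P0).
  have := ler_wpM2r aq0 up; have := ler_wpM2r cq0 down.
  move: (_ ^+ _ - _) (_ ^+ _ - _) => u w; lra.
have cvgl : (v c - v b) * (b ^+ d - (a + a * t) ^+ d) @[t --> (0 : R)^'+] -->
    (v c - v b) * (b ^+ d - a ^+ d).
  by apply: cvgM; [exact: cvg_cst|apply: cvgB; [exact: cvg_cst|exact: cvg_expr_affine]].
have cvgr : (v b - v a) * ((c + c * t) ^+ d - b ^+ d) @[t --> (0 : R)^'+] -->
    (v b - v a) * (c ^+ d - b ^+ d).
  by apply: cvgM; [exact: cvg_cst|apply: cvgB; [exact: cvg_expr_affine|exact: cvg_cst]].
apply: (ler_cvg_to cvgl cvgr); near=> t.
have t0 : 0 < t by near: t; exact: nbhs_right_gt.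
rewrite -(mulr1 a) -(mulr1 c) -!mulrA !mul1r -!mulrDr !mulr1; apply: approx.
  by rewrite ltrDl.
rewrite mulrDr mulr1 -ltrBrDl -ltr_pdivlMl//; near: t; apply: nbhs_right_lt.
by rewrite mulr_gt0 ?invr_gt0// subr_gt0.
Unshelve. all: by end_near. Qed.

Let ltr_exprd a b : 0 <= a -> a < b -> a ^+ d < b ^+ d.
Proof. by move=> a0 ab; rewrite ltrXn2r ?nnegrE// (le_trans a0)// ltW. Qed.

(** D is the left derivative of v as a function of r ^ d; by concavity it bounds
    the slopes of the chords on its left from below. *)
Lemma kneser_left_derivative r : 0 < r -> exists D : R,
  [/\ 0 <= D,
  (forall s, 0 < s -> s < r -> D * (r ^+ d - s ^+ d) <= v r - v s) &
  (v r - v (r - t)) / t @[t --> (0 : R)^'+] --> D * (d%:R * r ^+ n)].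
Proof.
move=> r0; pose g t := (v r - v (r - t)) / (r ^+ d - (r - t) ^+ d).
have gpos t : 0 < t -> t < r -> 0 < r ^+ d - (r - t) ^+ d.
  by move=> t0 tr; rewrite subr_gt0 ltr_exprd ?subr_ge0 ?(ltW tr)// gtrBl.
have lbg : lbound [set g t | t in `]0, r[] 0.
  move=> _ [t /= + <-]; rewrite in_itv /= => /andP[t0 tr].
  by apply: divr_ge0; [rewrite subr_ge0 v_le// gerBl ltW|exact/ltW/gpos].
exists (inf [set g t | t in `]0, r[]); split=> [|s s0 sr|].
- apply: lb_le_inf => //; exists (g (r / 2)); exists (r / 2) => //.
  by rewrite /= in_itv /= divr_gt0//= ltr_pdivrMr// mulr_natr mulr2n ltrDl.
-   have rs0 : 0 < r - s by rewrite subr_gt0.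
  have rsr : r - s < r by rewrite gtrBl.
  rewrite -ler_pdivlMr; last by have := gpos _ rs0 rsr; rewrite subKr.
  apply: ge_inf; first by exists 0.
  by exists (r - s); rewrite /= ?in_itv/= ?rs0// /g subKr.
have gcvg : g t @[t --> (0 : R)^'+] --> inf [set g t | t in `]0, r[].
  apply: (@nondecreasing_at_right_cvgr _ _ _ (BLeft r)); rewrite ?bnd_simp//.
    move=> t t'; rewrite !in_itv /= => /andP[t0 tr] /andP[t0' tr'].
    rewrite le_eqVlt => /predU1P[->//|tt'].
    rewrite /g ler_pdivrMr ?gpos// mulrAC ler_pdivlMr ?gpos//.
    have := @kneser_concave (r - t') (r - t) r.
    rewrite subr_gt0 ltrD2l ltrN2 gtrBl => /(_ tr' tt' t0); lra.
  by exists 0.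
have ecvg : ((r + -1 * t) ^+ d - r ^+ d) / (-1 * t) @[t --> 0^'+] --> d%:R * r ^+ n.
  by apply: cvg_exprB_quotient; rewrite oppr_eq0 oner_eq0.
apply: cvg_trans (cvgM gcvg ecvg); apply: near_eq_cvg; near=> t.
have t0 : 0 < t by near: t; exact: nbhs_right_gt.
have tr : t < r by near: t; exact: nbhs_right_lt.
rewrite /= /g mulN1r; have := gpos t t0 tr; move: (_ ^+ _) (_ ^+ _) => u w uw.
by field; rewrite !gt_eqF.
Unshelve. all: by end_near. Qed.

Lemma kneser_right_derivative r : 0 < r -> exists D : R,
  (v (r + t) - v r) / t @[t --> (0 : R)^'+] --> D.
Proof.
move=> r0; pose g t := (v (r + t) - v r) / ((r + t) ^+ d - r ^+ d).
have gpos t : 0 < t -> 0 < (r + t) ^+ d - r ^+ d.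
  by move=> t0; rewrite subr_gt0 ltr_exprd ?(ltW r0)// ltrDl.
have r2 : r / 2 < r by rewrite ltr_pdivrMr// mulr_natr mulr2n ltrDl.
have r20 : 0 < r ^+ d - (r / 2) ^+ d.
  by rewrite subr_gt0 ltr_exprd// divr_ge0// ltW.
exists (sup [set g t | t in `]0, 1[] * (d%:R * r ^+ n)).
have gcvg : g t @[t --> (0 : R)^'+] --> sup [set g t | t in `]0, 1[].
  apply: (@nonincreasing_at_right_cvgr _ _ _ (BLeft 1)); rewrite ?bnd_simp//.
    move=> t' t; rewrite !in_itv /= => /andP[t0 tr] /andP[t0' tr'].
    rewrite le_eqVlt => /predU1P[->//|tt'].
    rewrite /g ler_pdivrMr ?gpos// mulrAC ler_pdivlMr ?gpos//.
    have := @kneser_concave r (r + t') (r + t) r0.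
    rewrite ltrDl ltrD2l => /(_ t0 tt'); lra.
  exists ((v r - v (r / 2)) / (r ^+ d - (r / 2) ^+ d)) => _ [t /= + <-].
  rewrite in_itv /= => /andP[t0 _].
  rewrite /g ler_pdivrMr ?gpos// mulrAC ler_pdivlMr//.
  by apply: kneser_concave; rewrite ?divr_gt0// ltrDl.
have ecvg : ((r + 1 * t) ^+ d - r ^+ d) / (1 * t) @[t --> 0^'+] --> d%:R * r ^+ n.
  by apply: cvg_exprB_quotient; rewrite oner_eq0.
apply: cvg_trans (cvgM gcvg ecvg); apply: near_eq_cvg; near=> t.
have t0 : 0 < t by near: t; exact: nbhs_right_gt.
rewrite /= /g mul1r; have := gpos t t0; move: (_ ^+ _) (_ ^+ _) => u w uw.
by field; rewrite !gt_eqF.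
Unshelve. all: by end_near. Qed.

End kneser.

(** * The constant of the Minkowski content *)

Section gamma_three_halves.
Context {R : realType}.
Notation mu := (@lebesgue_measure R).

Let sqrtexp (u : R) : R := Num.sqrt u * expR (- u).

Let sqrtexp_continuous : continuous sqrtexp.
Proof.
move=> u; apply: cvgM; first exact: sqrt_continuous.
by apply: continuous_comp; [exact: opp_continuous|exact: continuous_expR].
Qed.

Let sqrtexp_measurable : measurable_fun setT sqrtexp.
Proof. exact: measurable_realfun.continuous_measurable_fun. Qed.

Let sqrtexp_ge0 u : 0 <= sqrtexp u.
Proof. by rewrite mulr_ge0 ?sqrtr_ge0 ?expR_ge0. Qed.

Let derive_sqr (x : R) : derive1 (@GRing.exp R ^~ 2) x = 2 * x.
Proof. by rewrite exp_derive1. Qed.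

Let is_derive_oppgauss (x : R) :
  is_derive x 1 (fun x => - gauss_fun x) (2 * x * gauss_fun x).
Proof.
rewrite /gauss_fun; apply: is_derive_eq.
by rewrite /GRing.scale /=; ring.
Qed.

Let derivable_LR (F : R -> R) (a b : R) :
  (forall x, derivable F x 1) -> derivable_oo_LRcontinuous F a b.
Proof.
move=> dF; have cF : continuous F.
  by move=> x; apply/differentiable_continuous/derivable1_diffP.
by split=> [x _//||]; [exact/cvg_at_right_filter/cF|exact/cvg_at_left_filter/cF].
Qed.

(** Substitute u = x ^ 2, then integrate x * (2 x exp (- x ^ 2)) by parts. *)
Let sqrtexp_truncated N :
  (\int[mu]_(u in `[0%R, (N ^ 2)%:R]) (sqrtexp u)%:E =
   (- (N%:R * gauss_fun (N%:R : R)))%:E +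
   \int[mu]_(x in `[0%R, N%:R]) (gauss_fun x)%:E)%E.
Proof.
case: N => [|N].
  by rewrite !set_itv1 !integral_set1 mul0r oppr0 adde0.
have N0 : 0 < N.+1%:R :> R by [].
have c2x : continuous (fun x : R => 2 * x).
  by move=> x; apply: cvgM; [exact: cvg_cst|exact: cvg_id].
have sqrE : derive1 (@GRing.exp R ^~ 2) = (fun x => 2 * x).
  by apply/funext => x; exact: derive_sqr.
have -> : (\int[mu]_(u in `[0%R, (N.+1 ^ 2)%:R]) (sqrtexp u)%:E =
    \int[mu]_(x in `[0%R, N.+1%:R]) (x * (2 * x * gauss_fun x))%:E)%E.
  have := @integration_by_substitution_increasing R (@GRing.exp R ^~ 2) sqrtexp
    0 N.+1%:R (ltW N0).
  rewrite expr0n/= -natrX sqrE => ->.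
  - apply: eq_integral => x; rewrite inE/= in_itv/= => /andP[x0 _]; congr EFin.
    by rewrite /sqrtexp fctE/= sqrtr_sqr ger0_norm// /gauss_fun; ring.
  - move=> x y; rewrite !in_itv/= => /andP[x0 _] /andP[y0 _] xy.
    by rewrite ltrXn2r ?nnegrE.
  - by move=> x _; exact: c2x.
  - by apply/cvg_ex; exists (2 * 0); exact/cvg_at_right_filter/c2x.
  - by apply/cvg_ex; exists (2 * N.+1%:R); exact/cvg_at_left_filter/c2x.
  - by apply: derivable_LR => x; exact: exprn_derivable.
  - exact: continuous_subspaceT.
rewrite (@integration_by_parts _ id (fun x => - gauss_fun x) (fun=> 1)
  (fun x => 2 * x * gauss_fun x)) //.
- rewrite mul0r subr0 mulrN; congr (_ + _)%E.
  have -> : (\int[mu]_(x in `[0%R, N.+1%:R]) (1 * - gauss_fun x)%:E =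
      \int[mu]_(x in `[0%R, N.+1%:R]) (- (gauss_fun x)%:E))%E.
    by apply: eq_integral => x _; rewrite mul1r EFinN.
  by rewrite integral_ge0N ?oppeK// => x _; rewrite lee_fin gauss_fun_ge0.
- by apply: continuous_subspaceT => x; exact: cvg_cst.
- by apply: derivable_LR.
- by move=> x _; rewrite derive1_id.
- apply: continuous_subspaceT => x; apply: cvgM; first exact: c2x.
  exact: continuous_gauss_fun.
- by apply: derivable_LR => x; have [] := is_derive_oppgauss x.
- by move=> x _; rewrite derive1E; have [] := is_derive_oppgauss x.
Qed.

Let cvg_mul_gauss : N%:R * gauss_fun (N%:R : R) @[N --> \oo] --> (0 : R).
Proof.
apply: (@squeeze_cvgr _ _ _ _ (fun=> 0) (fun N => 2 * harmonic N)).
- near=> N; rewrite mulr_ge0 ?gauss_fun_ge0//= /gauss_fun expRN.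
  rewrite ler_pdivrMr ?expR_gt0// mulrAC ler_pdivlMr//.
  have := expR_ge1Dx ((N%:R : R) ^+ 2); rewrite -natr1.
  have := sqr_ge0 (N%:R - 1 : R); nra.
- exact: cvg_cst.
- by rewrite -[0](mulr0 2); apply: cvgM; [exact: cvg_cst|exact: cvg_harmonic].
Unshelve. all: by end_near. Qed.

Lemma Gamma_three_halves : Gamma (1 + 1 / 2) = Num.sqrt pi / 2 :> R.
Proof.
have lim1 := @ge0_cvgn_integral R mu _ sqrtexp_ge0 sqrtexp_measurable.
have {}lim1 : (\int[mu]_(u in `[0%R, (N ^ 2)%:R]) (sqrtexp u)%:E @[N --> \oo] -->
    \int[mu]_(u in `[0%R, +oo[) (sqrtexp u)%:E)%E.
  apply: (@cvg_comp _ _ _ (fun N => (N ^ 2)%N) (fun N =>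
    \int[mu]_(u in `[0%R, N%:R]) (sqrtexp u)%:E)%E _ _ _ _ lim1).
  apply/cvgnyPge => M; near=> N.
  apply: (@leq_trans N); first by near: N; exact: nbhs_infty_ge.
  by rewrite -mulnn; case: (N) => // m; rewrite leq_pmulr.
have lim2 : (\int[mu]_(u in `[0%R, (N ^ 2)%:R]) (sqrtexp u)%:E @[N --> \oo] -->
    (0 + Num.sqrt pi / 2)%:E)%E.
  under eq_fun do rewrite sqrtexp_truncated.
  rewrite EFinD; apply: cvgeD => //.
    by apply: cvg_EFin; [exact: nearW|rewrite -oppr0; exact: cvgN cvg_mul_gauss].
  rewrite -integral0y_gauss.
  exact: (@ge0_cvgn_integral R mu _ (@gauss_fun_ge0 R) (@measurable_gauss_fun R)).
have intE := cvg_unique _ lim1 lim2.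
rewrite /Gamma /Rintegral.
have -> : (\int[mu]_(u in `]0%R, +oo[) (u `^ (1 + 1 / 2 - 1) * expR (- u))%:E =
    \int[mu]_(u in `]0%R, +oo[) (sqrtexp u)%:E)%E.
  apply: eq_integral => u; rewrite inE/= in_itv/= andbT => u0.
  by rewrite addrAC subrr add0r div1r powR12_sqrt// ltW.
rewrite integral_itv_obnd_cbnd ?intE ?add0r//.
by apply/measurable_realfun.measurable_EFinP; exact: measurable_funTS.
Unshelve. all: by end_near. Qed.

Lemma kappa1 : kappa 1 = 2 :> R.
Proof.
rewrite /kappa Gamma_three_halves div1r powR12_sqrt ?pi_ge0//.
by field; rewrite gt_eqF// sqrtr_gt0 pi_gt0.
Qed.

End gamma_three_halves.

(** * Points whose normal ray almost reaches the level r *)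

Section boundary_volume.
Context {R : realType} {n : nat}.
Notation T := 'rV[R]_n.+1.
Notation lambda := (@lebesgue_rV R n.+1).
Notation d := n.+1.
Variables A B : set T.
Hypothesis cA : closed A.
Hypothesis A0 : A !=set0.
Notation Y := (metric_proj_preimage A B).
Hypothesis finV : exists2 r : R, 0 < r & (lambda (parallel_set A r `&` Y) < +oo)%E.
Variable r : R.
Hypothesis r0 : 0 < r.
Notation dA := (rdist A).
Notation v := (slice_volume A Y).
Notation collar t := (parallel_set (boundary (parallel_set A r)) t).
Implicit Types (x y z : T) (s t a : R).

Lemma local_volume_le s t : s <= t -> v s <= v t.
Proof. exact: (slice_volume_le cA A0 finV (@subset_refl _ Y)). Qed.

Lemma local_volume_kneser (k a b : R) : 1 <= k -> 0 < a -> a <= b ->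
  v (k * b) - v (k * a) <= k ^+ d * (v b - v a).
Proof.
by move=> k1 _ ab; have := @shell_volume_shrink _ _ A cA A0 B setT a b k finV k1 ab;
  rewrite setIT; apply.
Qed.

Lemma collar_sub t : collar t `<=` [set z | r - t <= dA z < r + t].
Proof.
move=> z /parallel_setP[y /(rdist_boundary A0) yr zy] /=.
have := rdist_lipschitz A0 z y; have := rdist_lipschitz A0 y z.
rewrite (enormB y z) yr => h1 h2; apply/andP; split; lra.
Qed.

(** The segment from z to its foot meets the level r at distance d_A z - r. *)
Lemma collar_outer t : Y `&` [set z | r <= dA z < r + t] `<=` collar t.
Proof.
move=> z [[Uz _] /= /andP[rz zrt]]; have z0 : 0 < dA z by exact: lt_le_trans rz.
have k1 : 1 <= dA z / r by rewrite ler_pdivlMr// mul1r.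
apply/parallel_setP; exists (shrink A (dA z / r) z).
  apply: boundary_of_rdist => //; rewrite rdist_shrink//.
  by field; rewrite !gt_eqF.
rewrite enormB_shrink// (_ : dA z / (dA z / r) = r); first lra.
by field; rewrite !gt_eqF.
Qed.

(** If the ray from the foot of z through z is minimizing up to a point y at level
    t, then |z - y| + d_A z = t. The strict inequality with r in place of t makes
    the set open; for a point that is extendable for all s < r the ray does reach
    the level r. *)
Definition extendable s : set T :=
  [set z | exists2 y, s <= dA y & enorm (z - y) + dA z < r].

Lemma open_extendable s : open (extendable s).
Proof.
rewrite (_ : extendable s = \bigcup_(y in [set y | s <= dA y])
    [set z | enorm (z - y) + dA z < r]); last first.
  by apply/seteqP; split=> [z [y]|z [y]]; exists y.
apply: bigcup_open => y _.
apply: (@open_lt_lipschitz _ _ (fun z => enorm (z - y) + dA z) 2) => x z.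
have := enormB_lipschitz y x z; have := rdist_lipschitz A0 x z; lra.
Qed.

Lemma extendable_le s t : s <= t -> extendable t `<=` extendable s.
Proof. by move=> st z [y ty zy]; exists y => //; exact: le_trans ty. Qed.

Lemma shrink_extendable k s z : 1 <= k -> Unp A z -> s <= dA z < r ->
  extendable s (shrink A k z).
Proof.
move=> k1 Uz /andP[sz zr]; exists z => //.
by rewrite enormB enormB_shrink// rdist_shrink// subrK.
Qed.

(** For a q ^ i <= s, with q = r / s, the shell s <= d_A < r is carried by a
    shrinking of ratio s / (a q ^ i) onto extendable points of the shell from
    a q ^ i to a q ^ i.+1. Summing the resulting lower bounds telescopes; the last
    shell starts above s / q = s ^ 2 / r. *)
Lemma extendable_volume_ge D a s : 0 <= D -> 0 < a -> a < s -> s < r ->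
  D * (r ^+ d - s ^+ d) <= v r - v s ->
  D * ((s ^+ 2 / r) ^+ d - a ^+ d) <=
  slice_volume A (Y `&` extendable s) r - slice_volume A (Y `&` extendable s) a.
Proof.
move=> D0 a0 as_ sr Drs; have s0 : 0 < s by exact: lt_trans as_.
pose w := slice_volume A (Y `&` extendable s); rewrite -/w.
pose q := r / s.
have q1 : 1 < q by rewrite ltr_pdivlMr// mul1r.
have q0 : 0 < q by exact: lt_trans q1.
have [N /andP[Ns sN]] : exists N, q ^+ N <= s / a < q ^+ N.+1.
  by apply: exists_expr_between; rewrite ?ler_pdivlMr ?mul1r// ltW.
have w_le t u : t <= u -> w t <= w u.
  exact: (slice_volume_le cA A0 finV (@subIsetl _ Y (extendable s))).
have shells M : (M <= N)%N -> D * ((a * q ^+ M) ^+ d - a ^+ d) <= w (a * q ^+ M) - w a.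
  elim: M => [|M IH] MN; first by rewrite expr0 mulr1 !subrr mulr0.
  have qM0 : 0 < a * q ^+ M by rewrite mulr_gt0// exprn_gt0.
  pose k := s / (a * q ^+ M).
  have k1 : 1 <= k.
    rewrite /k ler_pdivlMr// mul1r mulrC -ler_pdivlMr// (le_trans _ Ns)//.
    by rewrite ler_weXn2l ?(ltW q1)// ltnW.
  have k0 : 0 < k by exact: lt_le_trans k1.
  have qMS : a * q ^+ M <= a * q ^+ M.+1.
    by rewrite ler_pM2l// ler_weXn2l// ltW.
  have ks : k * (a * q ^+ M) = s by rewrite /k divfK// gt_eqF.
  have kr : k * (a * q ^+ M.+1) = r.
    by rewrite exprSr !mulrA -(mulrA k) ks /q; field; rewrite gt_eqF.
  have := @shell_volume_shrink _ _ A cA A0 B (extendable s) _ _ k finV k1 qMS.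
  rewrite ks kr -/w => /(_ _)/(le_trans Drs).
  have -> : D * (r ^+ d - s ^+ d) =
      k ^+ d * (D * ((a * q ^+ M.+1) ^+ d - (a * q ^+ M) ^+ d)).
    by rewrite mulrCA; congr (_ * _); rewrite mulrBr -!exprMn ks kr.
  rewrite ler_pM2l ?exprn_gt0// => step.
  have := IH (ltnW MN); have := step (fun z Yz => shrink_extendable k1 Yz.1).
  lra.
apply: le_trans (le_trans (shells N (leqnn N)) _); last first.
  rewrite lerD2r w_le// (le_trans _ (ltW sr))// mulrC -ler_pdivlMr//.
rewrite (_ : s ^+ 2 / r = s / q); last by rewrite /q; field; rewrite !gt_eqF.
rewrite ler_wpM2l// lerD2r lerXn2r ?nnegrE ?mulr_ge0 ?divr_ge0 ?exprn_ge0
  ?invr_ge0 ?(ltW s0) ?(ltW q0) ?(ltW a0)//.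
rewrite ler_pdivrMr// -mulrA -exprSr mulrC -ler_pdivrMr//; exact: ltW.
Qed.

(** If z is not in the collar, no point of the closed ball of radius r - a around
    z reaches the level r; by compactness d_A stays below some M < r on this ball, and z is not
    extendable to levels above M. *)
Lemma bigcap_extendable_sub t a (s : nat -> R) : 0 < a -> r - t < a -> a < r ->
  (forall e, 0 < e -> exists i, r - e < s i) ->
  [set z | a <= dA z < r] `&` \bigcap_i extendable (s i) `<=` collar t.
Proof.
move=> a0 rta ar sr z [/= /andP[az zr] zext]; apply: contrapT => nz.
pose K : set T := [set y | enorm (y - z) <= r - a].
have Kz : K z by rewrite /K /= subrr enorm0 subr_ge0 ltW.
have Kr y : K y -> dA y < r.
  move=> Ky; rewrite ltNge; apply/negP => ry; apply: nz.
  apply: (near_boundary_of_crossing A0 r0 (y := y)); first by rewrite (ltW zr).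
  rewrite enormB; apply: le_lt_trans Ky _; lra.
have cK : compact K.
  apply: bounded_closed_compact.
    exists (`|z| + (r - a)); split; first exact: num_real.
    move=> M zM y Ky; apply: le_trans (ltW zM).
    rewrite -[y](subrK z) addrC (le_trans (ler_normD _ _))// lerD2l.
    exact: le_trans (mx_norm_le_enorm _) Ky.
  apply: (@closed_comp _ _ (fun y : T => enorm (y - z)) [set s | s <= r - a]) => [y _|];
    last exact: closed_le.
  by apply: (@lipschitz_continuous _ _ _ 1) => x y'; rewrite mul1r enormB_lipschitz.
have [c cinK cmax] : exists2 c, c \in K & forall y, y \in K -> dA y <= dA c.
  apply: compact_EVT_max => //; first by exists z.
  exact/continuous_subspaceT/rdist_continuous.
have [i si] : exists i, r - (r - dA c) < s i.
  by apply: sr; rewrite subr_gt0; apply: Kr; rewrite inE in cinK.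
have [y sy zy] := zext i I.
have Ky : K y by rewrite /K /= enormB; lra.
have := cmax y (mem_set Ky); lra.
Qed.

End boundary_volume.

(** * Volume of the collar of the boundary, and the theorem *)

Section collar_volume.
Context {R : realType} {n : nat}.
Notation T := 'rV[R]_n.+1.
Notation lambda := (@lebesgue_rV R n.+1).
Notation d := n.+1.
Variables A B : set T.
Hypothesis cA : closed A.
Hypothesis A0 : A !=set0.
Notation Y := (metric_proj_preimage A B).
Hypothesis finV : exists2 r : R, 0 < r & (lambda (parallel_set A r `&` Y) < +oo)%E.
Variable r : R.
Hypothesis r0 : 0 < r.
Notation dA := (rdist A).
Notation v := (slice_volume A Y).
Notation collar t := (parallel_set (boundary (parallel_set A r)) t).
Implicit Types (x y z : T) (s t a : R).

Lemma shell_caratheodory a b : lambda.-caratheodory [set z | a <= dA z < b].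
Proof.
rewrite (_ : [set z | _] = parallel_set A b `\` parallel_set A a).
  by apply: caratheodory_measurable_setD; exact/open_caratheodory/open_parallel_set.
apply/seteqP; split=> z /=; rewrite !parallel_rdist//.
  by move=> /andP[az zb]; split => //; apply/negP; rewrite -leNgt.
by move=> [zb /negP]; rewrite -leNgt zb => ->.
Qed.

Lemma collar_volume_le t : 0 <= t ->
  (lambda (collar t `&` Y) <= (v (r + t) - v (r - t))%:E)%E.
Proof.
move=> t0; have rt : r - t <= r + t by lra.
rewrite -(shell_volume cA A0 finV (@subset_refl _ Y) rt).
by apply: le_outer_measure; apply: setSI; exact: collar_sub.
Qed.

(** The bound of [extendable_volume_ge] passes to the limit s = r along a
    decreasing sequence of sets. *)
Lemma collar_volume_inner D a t : 0 <= D -> 0 < a -> r - t < a -> a < r ->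
  (forall s, 0 < s -> s < r -> D * (r ^+ d - s ^+ d) <= v r - v s) ->
  ((D * (r ^+ d - a ^+ d))%:E <= lambda (collar t `&` Y `&` parallel_set A r))%E.
Proof.
move=> D0 a0 ta ar Dv.
have ra0 : 0 < r - a by rewrite subr_gt0.
pose s i : R := r - (r - a) / 2 * harmonic i.
have sr i : s i < r by rewrite /s gtrBl mulr_gt0 ?divr_gt0 ?invr_gt0.
have as_ i : a < s i.
  have : harmonic i <= (1 : R) by rewrite /= invf_le1// ler1n.
  have := @harmonic_gt0 R i; rewrite /s; move: (harmonic i) => h h0 h1; nra.
have s_cvg : s i @[i --> \oo] --> r.
  rewrite -[X in _ --> X]subr0 -(mulr0 ((r - a) / 2)).
  by apply: cvgB; [exact: cvg_cst|apply: cvgM; [exact: cvg_cst|exact: cvg_harmonic]].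
pose F i := [set z | a <= dA z < r] `&` extendable A r (s i).
have Fvol i : lambda (F i `&` Y) =
    (slice_volume A (Y `&` extendable A r (s i)) r -
     slice_volume A (Y `&` extendable A r (s i)) a)%:E.
  rewrite -(shell_volume cA A0 finV (@subIsetl _ Y (extendable A r (s i))) (ltW ar)).
  by rewrite /F -setIA [_ `&` Y]setIC.
have Fcvg : lambda (F i `&` Y) @[i --> \oo] --> lambda ((\bigcap_i F i) `&` Y).
  apply: cvg_lebesgue_rV_bigcap.
  - move=> i; apply: caratheodory_measurable_setI; first exact: shell_caratheodory.
    exact/open_caratheodory/open_extendable.
  - move=> i j ij; apply/subsetPset; apply: setIS; apply: extendable_le.
    rewrite lerD2l lerN2 ler_pM2l ?divr_gt0//.
    by rewrite lef_pV2 ?posrE// ler_nat ltnS.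
  - by rewrite Fvol ltry.
have polycvg : (D * ((s i ^+ 2 / r) ^+ d - a ^+ d))%:E @[i --> \oo] -->
    (D * (r ^+ d - a ^+ d))%:E.
  apply: cvg_EFin; first exact: nearW.
  apply: cvgM; first exact: cvg_cst.
  apply: cvgB; last exact: cvg_cst.
  apply: (@continuous_cvg _ _ _ _ _ (fun i => s i ^+ 2 / r) (fun x : R => x ^+ d)).
    exact: exprn_continuous.
  rewrite [X in _ --> X](_ : r = r ^+ 2 / r); last by field; rewrite gt_eqF.
  apply: cvgM; last exact: cvg_cst.
  by rewrite expr2; apply: cvgM.
apply: le_trans (_ : (_ <= lambda ((\bigcap_i F i) `&` Y))%E) _.
  apply: (lee_cvg_to polycvg Fcvg); apply: nearW => i.
  rewrite Fvol lee_fin; apply: extendable_volume_ge => //.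
  by apply: Dv => //; exact: lt_trans (as_ i).
apply: le_outer_measure => z [zF Yz].
have [/= zar _] := zF 0%N I.
split; last by rewrite parallel_rdist//; case/andP: zar.
split => //; apply: (@bigcap_extendable_sub _ _ A A0 r r0 t a s) => //.
  move=> e e0; have : \forall i \near \oo, `|r - s i| < e by apply: cvgr_dist_lt.
  by move=> [i _ /(_ i (leqnn i)) /=]; rewrite ltr_norml => ?; exists i; lra.
by split => // i _; have [] := zF i I.
Qed.

(** The collar is cut along the open set A_r, and a tends to r - t in the bound
    for its inner part. *)
Lemma collar_volume_ge D t : 0 <= D -> 0 < t -> t < r ->
  (forall s, 0 < s -> s < r -> D * (r ^+ d - s ^+ d) <= v r - v s) ->
  ((D * (r ^+ d - (r - t) ^+ d) + (v (r + t) - v r))%:E <= lambda (collar t `&` Y))%E.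
Proof.
move=> D0 t0 tr Dv.
rewrite (open_caratheodory (@open_parallel_set _ _ _ A0 r) (collar t `&` Y)).
rewrite EFinD; apply: leeD.
  have ecvg : (D * (r ^+ d - (r - t + 1 * u) ^+ d))%:E @[u --> (0 : R)^'+] -->
      (D * (r ^+ d - (r - t) ^+ d))%:E.
    apply: cvg_EFin; first exact: nearW.
    apply: cvgM; first exact: cvg_cst.
    by apply: cvgB; [exact: cvg_cst|exact: cvg_expr_affine].
  apply: (cvge_to_le ecvg); near=> u.
  have u0 : 0 < u by near: u; exact: nbhs_right_gt.
  have ut : u < t by near: u; exact: nbhs_right_lt.
  rewrite mul1r; apply: collar_volume_inner => //; lra.
have rt : r <= r + t by rewrite lerDl ltW.
rewrite -(shell_volume cA A0 finV (@subset_refl _ Y) rt).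
apply: le_outer_measure => z [zrt Yz]; split.
  by split => //; apply: (collar_outer cA A0 r0 (B := B)); split.
by rewrite /= parallel_rdist// => zr; case/andP: zrt; rewrite leNgt zr.
Unshelve. all: by end_near. Qed.

End collar_volume.

Section theorem.
Context {R : realType} {n : nat}.
Notation T := 'rV[R]_n.+1.
Implicit Types (A B : set T).

Lemma local_parallel_volume_set0 B (r : R) :
  local_parallel_volume (set0 : set T) B r = 0%E.
Proof.
rewrite /local_parallel_volume (_ : _ `&` _ = set0) ?lebesgue_rV0//.
by rewrite -subset0 => z [/parallel_setP[]].
Qed.

(** Divided by kappa_1 t = 2 t, both bounds of the volume of the collar tend to
    half the sum of the one-sided derivatives. *)
Lemma boundary_content_of_nonempty A B (r : R) : closed A -> A !=set0 ->
  (exists2 r : R, 0 < r & (local_parallel_volume A B r < +oo)%E) -> 0 < r ->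
  exists Dl Dr : R,
  [/\ has_left_derivative (local_parallel_volume A B) r Dl,
      has_right_derivative (local_parallel_volume A B) r Dr
    & has_minkowski_content n%:R (boundary (parallel_set A r))
        (metric_proj_preimage A B) (2^-1 * (Dl + Dr))%:E].
Proof.
move=> cA A0 finV r0; pose v := slice_volume A (metric_proj_preimage A B).
have VE x : local_parallel_volume A B x = (v x)%:E.
  exact: (slice_volumeE cA A0 finV (@subset_refl _ _)).
have v_le := local_volume_le cA A0 finV.
have v_kneser := local_volume_kneser cA A0 finV.
have [D [D0 Dv left_cvg]] := kneser_left_derivative v_le v_kneser r0.
have [Dr right_cvg] := kneser_right_derivative v_le v_kneser r0.
exists (D * (n.+1%:R * r ^+ n)), Dr; split.
- apply/cvg_at_leftNP; rewrite oppr0.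
  under eq_fun do rewrite /= !VE -EFinB -EFinM.
  apply: cvg_EFin; first exact: nearW.
  apply: cvg_trans left_cvg; apply: near_eq_cvg; near=> t.
  by rewrite /= invrN mulrN -mulNr opprB.
- rewrite /has_right_derivative; under eq_fun do rewrite !VE -EFinB -EFinM.
  by apply: cvg_EFin; first exact: nearW.
have normE (t : R) : 0 < t ->
    kappa (n.+1%:R - n%:R) * t `^ (n.+1%:R - n%:R) = 2 * t.
  by move=> t0; rewrite -natr1 addrAC subrr add0r kappa1 powRr1// ltW.
apply: (@squeeze_cvge _ _ _ _
  (fun t => (2^-1 * ((D * ((r ^+ n.+1 - (r - t) ^+ n.+1) / t))
                     + (v (r + t) - v r) / t))%:E) _
  (fun t => (2^-1 * ((v r - v (r - t)) / t + (v (r + t) - v r) / t))%:E)).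
- near=> t.
  have t0 : 0 < t by near: t; exact: nbhs_right_gt.
  have tr : t < r by near: t; exact: nbhs_right_lt.
  have t20 : 0 < (2 * t)^-1 by rewrite invr_gt0 mulr_gt0.
  rewrite normE//; apply/andP; split.
  + rewrite (_ : 2^-1 * _ = (D * (r ^+ n.+1 - (r - t) ^+ n.+1) +
      (v (r + t) - v r)) * (2 * t)^-1); last by field; rewrite gt_eqF.
    by rewrite EFinM lee_wpmul2r ?lee_fin ?(ltW t20)// collar_volume_ge.
  + rewrite (_ : 2^-1 * _ = (v (r + t) - v (r - t)) * (2 * t)^-1); last first.
      by field; rewrite gt_eqF.
    by rewrite EFinM lee_wpmul2r ?lee_fin ?(ltW t20)// collar_volume_le// ltW.
- apply: cvg_EFin; first exact: nearW.
  apply: cvgM; first exact: cvg_cst.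
  apply: cvgD; last exact: right_cvg.
  apply: cvgM; first exact: cvg_cst.
  have ecvg : ((r + -1 * t) ^+ n.+1 - r ^+ n.+1) / (-1 * t) @[t --> 0^'+] -->
      n.+1%:R * r ^+ n.
    by apply: cvg_exprB_quotient; rewrite oppr_eq0 oner_eq0.
  apply: cvg_trans ecvg; apply: near_eq_cvg; near=> t.
  by rewrite /= mulN1r invrN mulrN -mulNr opprB.
- apply: cvg_EFin; first exact: nearW.
  apply: cvgM; first exact: cvg_cst.
  by apply: cvgD.
Unshelve. all: by end_near. Qed.

End theorem.

Theorem theorem2p5 (R : realType) (d : nat) (hd : (0 < d)%N)
  (A B : set 'rV[R]_d) (clA : closed A) (borelB : borel B)
  (finV : exists2 r : R, 0 < r & (local_parallel_volume A B r < +oo)%E)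
  (r : R) (r0 : 0 < r) :
  exists Dl Dr M : R,
    [/\ has_left_derivative (local_parallel_volume A B) r Dl,
        has_right_derivative (local_parallel_volume A B) r Dr,
        has_minkowski_content d.-1%:R (boundary (parallel_set A r))
          (metric_proj_preimage A B) M%:E
      & M = 2^-1 * (Dl + Dr)].
Proof.
case: d hd A B clA borelB finV => // n _ A B clA _ finV /=.
have [A0|A0] := pselect (A !=set0).
  have [Dl [Dr [hl hr hM]]] := boundary_content_of_nonempty clA A0 finV r0.
  by exists Dl, Dr, (2^-1 * (Dl + Dr)).
have -> : A = set0 by apply/eqP/negPn/negP => /set0P.
exists 0, 0, 0; split; last by rewrite addr0 mulr0.
- rewrite /has_left_derivative; under eq_fun do rewrite !local_parallel_volume_set0 sube0 mul0e.
  exact: cvg_cst.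
- rewrite /has_right_derivative; under eq_fun do rewrite !local_parallel_volume_set0 sube0 mul0e.
  exact: cvg_cst.
rewrite /has_minkowski_content.
under eq_fun => t.
  rewrite (_ : _ `&` _ = set0) ?lebesgue_rV0 ?mul0e; first over.
  by rewrite -subset0 => z [_ [[a [[+ _] _]] _]]; rewrite closure0.
exact: cvg_cst.
Qed.
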